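(* There exists a set $D_\diamond\subset\mathbb C^2\setminus\Delta$ such that (i) $D_\diamond$ is a bijectivity domain, meaning that $F_\diamond(D_\diamond)=D_\diamond$ and the map $F_\diamond:D_\diamond\to D_\diamond$ is bijective except on parts of the boundary of $D_\diamond$; (ii) $D_\diamond$ has finite product structure: there exists a finite collection of sets $Z_1,W_1,\dots,Z_N,W_N\subset\mathbb C$ such that $$D_\diamond=\bigcup_{k=1}^{N}(Z_k\times W_k),$$ with each $W_k$ consistent; (iii) each set $Z_k$ and $W_k$ in the union in (ii) can be given explicitly, and each is a connected set whose boundary consists of straight lines (infinite or segments) and arcs of circles.
   Context: $\Delta=\{(z,w)\in\mathbb C^2: z=w\}$. Put $T(z)=z+1$, $U(z)=z+i$, $S(z)=-1/z$, and $\Phi_\diamond=\{x+yi: |x|+|y|\le 1\}$. The map $f_\diamond:\mathbb C\to\mathbb C$ is defined piecewise by: $f_\diamond(z)=Sz$ if $z\in\Phi_\diamond$; and for $z\notin\Phi_\diamond$: $f_\diamond(z)=T^{-1}z$ if $-\pi/4\le\arg z<\pi/4$; $f_\diamond(z)=U^{-1}z$ if $\pi/4\le\arg z<3\pi/4$; $f_\diamond(z)=Tz$ if $3\pi/4\le\arg z$ or $\arg z<-3\pi/4$; $f_\diamond(z)=Uz$ if $-3\pi/4\le\arg z<-\pi/4$. (Arguments are taken between $-\pi$ and $\pi$.) The natural extension map $F_\diamond:\mathbb C^2\setminus\Delta\to\mathbb C^2\setminus\Delta$ is $F_\diamond(z,w)=(hz,hw)$, where $h\in\{S,T^{-1},U^{-1},T,U\}$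 is the map by which $f_\diamond$ acts at $w$ (so the choice of $h$ depends only on $w$). A subset of $\mathbb C$ is called consistent if $f_\diamond$ acts on all points in the set by the same generator among $S,T^{-1},U^{-1},T,U$, i.e. the set is contained in only one of the regions in the definition of $f_\diamond$. A set in $\mathbb C^2$ has finite product structure if it can be expressed as a finite union of Cartesian products $Z_k\times W_k$ in which each $W_k$ is consistent.
   Formalization: Since S(0) is not in C, the map F is undefined at w=0 and at z=0 with w in the diamond; here z ranges over the Riemann sphere, F is restricted to w≠0, D lies in sphere × C off the diagonal, and the shape conditions in (iii) concern the finite part of each Z_k. *)

(* Defs.v *)
From HB Require Import structures.
From mathcomp Require Import all_boot all_order all_algebra.
From mathcomp Require Import complex.
From mathcomp Require Import all_classical all_reals all_analysis.

Set Implicit Arguments.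
Unset Strict Implicit.
Unset Printing Implicit Defensive.

Import Order.TTheory GRing.Theory Num.Theory.
Import numFieldNormedType.Exports.

Local Open Scope classical_set_scope.
Local Open Scope complex_scope.
Local Open Scope ring_scope.

(* [R[i]^o] is [R[i]] with the topology given by the modulus. *)
Notation Cplx R := (R[i]^o).

(* The Riemann sphere: [Some z] is a finite point, [None] is infinity. *)
Notation sphere R := (one_point_compactification (Cplx R)).

Definition boundary (T : topologicalType) (A : set T) : set T :=
  closure A `\` A°.

(* The principal argument, in ]-pi, pi]; the value at 0 is irrelevant. *)
Definition arg (R : realType) (z : Cplx R) : R :=
  let t := acos (complex.Re z / Normc.normc z) in
  if 0 <= complex.Im z then t else - t.

Lemma argP (R : realType) (z : Cplx R) : z != 0 ->
  [/\ - pi < arg z, arg z <= pi,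
      complex.Re z = Normc.normc z * cos (arg z) &
      complex.Im z = Normc.normc z * sin (arg z)].
Proof.
case: z => x y z0; rewrite /arg /=; set m := Num.sqrt _.
have s0 : 0 < x ^+ 2 + y ^+ 2.
  rewrite lt_neqAle addr_ge0 ?sqr_ge0// andbT eq_sym paddr_eq0 ?sqr_ge0//.
  by rewrite !sqrf_eq0; apply: contra z0 => /andP[/eqP-> /eqP->].
have m0 : 0 < m by rewrite sqrtr_gt0.
have m2 : m ^+ 2 = x ^+ 2 + y ^+ 2 by rewrite sqr_sqrtr// ltW.
have xm1 : (x / m) ^+ 2 <= 1.
  by rewrite expr_div_n ler_pdivrMr ?exprn_gt0// mul1r m2 lerDl sqr_ge0.
have xm : -1 <= x / m <= 1.
  by rewrite -ler_norml -(@expr_le1 _ 2)// -normrX ger0_norm// sqr_ge0.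
have cosE : cos (acos (x / m)) = x / m by rewrite acosK.
have sinE : m * sin (acos (x / m)) = `|y|.
  have u0 : 0 <= m * Num.sqrt (1 - (x / m) ^+ 2).
    by rewrite mulr_ge0 ?sqrtr_ge0 ?(ltW m0).
  rewrite sin_acos// -(ger0_norm u0) -!sqrtr_sqr exprMn.
  rewrite [X in _ * X]sqr_sqrtr ?subr_ge0//.
  congr (Num.sqrt _); rewrite mulrBr mulr1 expr_div_n mulrCA mulfV ?mulr1.
    by rewrite m2 addrAC subrr add0r.
  by rewrite expf_neq0 ?gt_eqF.
have mx : x = m * (x / m) by rewrite mulrCA mulfV ?gt_eqF// mulr1.
have t0 : 0 <= acos (x / m) by exact: acos_ge0.
have tpi : acos (x / m) <= pi by exact: acos_lepi.
case: ifPn => [y0|]; rewrite ?cosN ?sinN ?cosE ?mulrN sinE.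
  split=> //; last by rewrite ger0_norm.
  by rewrite (lt_le_trans _ t0)// oppr_lt0 pi_gt0.
rewrite -ltNge => y0; split=> //; last by rewrite ltr0_norm// opprK.
  rewrite ltrN2 lt_neqAle tpi andbT; apply/eqP => tE.
  move: sinE; rewrite tE sinpi mulr0 => /esym/eqP.
  by rewrite normr_eq0 lt_eqF.
by rewrite (le_trans _ (pi_ge0 R))// oppr_le0.
Qed.

(* The generators S, T^-1, U^-1, T, U. *)
Inductive generator := genS | genTV | genUV | genT | genU.

(* [mobius genS 0] is a junk value; [mobius_sphere] is the actual action. *)
Definition mobius (R : realType) (h : generator) (z : Cplx R) : Cplx R :=
  match h with
  | genS => - z^-1
  | genTV => z - 1
  | genUV => z - (0 +i* 1)
  | genT => z + 1
  | genU => z + (0 +i* 1)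
  end.

Definition mobius_sphere (R : realType) (h : generator) (z : sphere R) :
    sphere R :=
  match h, z with
  | genS, None => Some 0
  | genS, Some z => if z == 0 then None else Some (mobius genS z)
  | _, None => None
  | h, Some z => Some (mobius h z)
  end.

Definition Phi_diamond (R : realType) (z : Cplx R) : bool :=
  `|complex.Re z| + `|complex.Im z| <= 1.

(* The generator by which f_diamond acts at z. *)
Definition branch (R : realType) (z : Cplx R) : generator :=
  if Phi_diamond z then genS
  else if (- (pi / 4) <= arg z) && (arg z < pi / 4) then genTV
  else if (pi / 4 <= arg z) && (arg z < 3 * pi / 4) then genUV
  else if (3 * pi / 4 <= arg z) || (arg z < - (3 * pi / 4)) then genT
  else genU.

Definition f_diamond (R : realType) (z : Cplx R) : Cplx R :=
  mobius (branch z) z.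

Definition off_diagonal (R : realType) : set (sphere R * Cplx R) :=
  [set p | p.1 <> Some p.2].

(* Since S 0 = oo, the first coordinate lives on the sphere: a point (0, w)
   may have (oo, S w) as its only preimage. The second coordinate stays in C,
   where f_diamond is given, and w = 0, where it leaves C, ends the orbit. *)
Definition F_diamond (R : realType) (p : sphere R * Cplx R) :
    sphere R * Cplx R :=
  (mobius_sphere (branch p.2) p.1, f_diamond p.2).

Definition F_domain (R : realType) : set (sphere R * Cplx R) :=
  off_diagonal (R:=R) `&` [set p | p.2 <> 0].

Definition bijectivity_domain (R : realType) (D : set (sphere R * Cplx R)) :=
  @F_diamond R @` (D `&` F_domain (R:=R)) = D /\
  exists2 E, E `<=` boundary D &
    set_bij ((D `&` F_domain (R:=R)) `\` E) D (@F_diamond R).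

Definition consistent (R : realType) (W : set (Cplx R)) :=
  exists h, forall w, W w -> branch w = h.

Definition finite_part (R : realType) (Z : set (sphere R)) : set (Cplx R) :=
  [set z | Z (Some z)].

Section Curves.
Context {R : realType}.
Implicit Types L : set (Cplx R).

Definition is_line L := exists a v : Cplx R,
  v != 0 /\ L = [set z | exists t : R, z = a + t%:C * v].

Definition is_half_line L := exists a v : Cplx R,
  v != 0 /\ L = [set z | exists2 t : R, 0 <= t & z = a + t%:C * v].

Definition is_segment L := exists a b : Cplx R,
  L = [set z | exists2 t : R, 0 <= t <= 1 & z = (1 - t)%:C * a + t%:C * b].

Definition is_arc L := exists (c : Cplx R) (r alpha beta : R),
  [/\ 0 < r, alpha <= beta &
   L = [set z | exists2 t : R, alpha <= t <= beta &
                  z = c + r%:C * (cos t +i* sin t)]].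

Definition bounded_by_lines_and_arcs (A : set (Cplx R)) :=
  exists (n : nat) (L : 'I_n -> set (Cplx R)),
    (forall j, [\/ is_line (L j), is_half_line (L j), is_segment (L j) |
                   is_arc (L j)]) /\
    boundary A = \bigcup_j L j.

End Curves.

(* Finite descriptions of plane sets: Boolean combinations of conditions
   0 <= a |z|^2 + b Re z + c Im z + d (a half-plane, a disk, or the exterior
   of a disk) with integer coefficients. *)
Inductive description :=
  | Ineq of int & int & int & int
  | Compl of description
  | Inter of description & description.

Fixpoint described (R : realType) (e : description) (z : Cplx R) : bool :=
  match e with
  | Ineq a b c d =>
      0 <= a%:~R * (complex.Re z ^+ 2 + complex.Im z ^+ 2)
           + b%:~R * complex.Re z + c%:~R * complex.Im z + d%:~R
  | Compl e1 => ~~ described e1 z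
  | Inter e1 e2 => described e1 z && described e2 z
  end.

Definition explicit (R : realType) (A : set (Cplx R)) :=
  exists e : description, A = [set z | described e z].

Definition explicit_region (R : realType) (A : set (Cplx R)) :=
  [/\ explicit A, connected A & bounded_by_lines_and_arcs A].

(* Main.v *)
(* The rotations by powers of i permute the branches of f_diamond, so it
   suffices to describe the domain up to rotation: the plane of w is cut into
   sixteen cells, seven inside the diamond and nine outside, on each of which
   the fibre in z is an explicit union of regions bounded by lines and circles.
   In the homogeneous coordinates (|z|^2, Re z, Im z, 1), translations,
   rotations and inversion are linear and all these regions are polyhedral, so
   the inclusions behind F(D) = D and D off the diagonal are decided by
   Fourier-Motzkin elimination, once a few polyhedra that miss the quadric
   |z|^2 * 1 = (Re z)^2 + (Im z)^2 have been set aside.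

   Bijectivity: two interior points of D with the same image use the same
   generator, because the inequalities satisfied by the fibres are strict in the
   interior. Hence a choice of preimages that takes an interior one whenever
   there is one leaves out boundary points only.

   Boundaries: on one of the curves that cut out a region, membership in the
   boundary of the region can only change where another curve crosses it, that
   is, at finitely many points.

   Connectedness: each region is convex, or star-shaped, or each of its points
   can be joined by a segment to a convex part of it, or it is the image of such
   a region under z |-> 1/z. *)

From Stdlib Require Import BinInt.
Require Import Defs.
From mathcomp Require Import all_boot all_order all_algebra.
From mathcomp Require Import complex ring lra ssrZ.
From mathcomp Require Import all_classical all_reals all_analysis.
Set Implicit Arguments.
Unset Strict Implicit.
Unset Printing Implicit Defensive.
Import Order.TTheory GRing.Theory Num.Theory.
Import numFieldNormedType.Exports.
Local Open Scope classical_set_scope.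
Local Open Scope complex_scope.
Local Open Scope ring_scope.

(* Fourier-Motzkin elimination sees a region in all of R^4, whereas the points that matter lie on
   the light cone n d = x^2 + y^2 with n, d >= 0. A true inclusion can therefore fail in R^4 because
   of vectors off the cone; each void is a polyhedron that the cone provably misses, and listing it
   among the covering regions removes such vectors. Every test is one-sided: [true] is a
   certificate, and nothing is deduced from [false]. The tests are run by [vm_compute], hence the
   binary integers [Z] as coefficients.

   The equality F(D) = D is required at the boundary points as well. This forces half-open cells
   that follow the half-open sectors of [branch], and thin cells (rays, arcs, diagonals, a vertex)
   that differ in fibre or branch from the two-dimensional cells beside them. In homogeneous
   coordinates infinity is an ordinary ray, so z = 0 and z = infinity need no separate treatment in
   the tests. *)
Delimit Scope Z_scope with coqZ.

(** * Systems of linear inequalities *)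

(* [(s, f)] is the homogeneous inequality [0 < f] if [s], and [0 <= f] if not,
   where [f] lists the coefficients of a linear form. *)
Definition constraint := (bool * seq Z)%type.

Definition zval (R : numDomainType) (a : Z) : R := (int_of_Z a)%:~R.

Fixpoint lform (R : numDomainType) (f : seq Z) (v : seq R) : R :=
  match f, v with
  | a :: f', x :: v' => zval R a * x + lform f' v'
  | _, _ => 0
  end.

Definition holds (R : numDomainType) (v : seq R) (A : constraint) : bool :=
  if A.1 then 0 < lform A.2 v else 0 <= lform A.2 v.

Definition region := seq constraint.

Definition inside (R : numDomainType) (H : region) (v : seq R) : bool :=
  all (holds v) H.

Definition opposite (A : constraint) : constraint :=
  (~~ A.1, map Z.opp A.2).

Fixpoint lcomb (s t : Z) (f g : seq Z) : seq Z :=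
  match f, g with
  | [::], _ => map (Z.mul t) g
  | _, [::] => map (Z.mul s) f
  | a :: f', b :: g' => Z.add (Z.mul s a) (Z.mul t b) :: lcomb s t f' g'
  end.

Definition null_form (f : seq Z) : bool := all (Z.eqb 0) f.

(** Serves only to prune, and may answer [true] on lists of different lengths. That is safe because
    forgetting a constraint merely enlarges a region. *)
Fixpoint same_form (f g : seq Z) : bool :=
  match f, g with
  | a :: f', b :: g' => if Z.eqb a b then same_form f' g' else false
  | _, _ => nilp f
  end.

Definition same (A B : constraint) : bool :=
  if same_form A.2 B.2 then Bool.eqb A.1 B.1 else false.

Fixpoint occurs (A : constraint) (H : region) : bool :=
  if H is B :: H' then if same A B then true else occurs A H' else false.

Definition simplify (H : region) : region :=
  foldr (fun A H' => if ~~ A.1 && null_form A.2 then H'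
                     else if occurs A H' then H' else A :: H') [::] H.

(* One step of Fourier-Motzkin elimination. *)
Definition eliminate (H : region) : region :=
  let hd (A : constraint) := head Z0 A.2 in
  let zero := [seq (A.1, behead A.2) | A <- H & Z.eqb (hd A) 0] in
  let mixed := [seq (A.1 || B.1,
                    lcomb (- hd B) (hd A) (behead A.2) (behead B.2))
               | A <- [seq A <- H | Z.ltb 0 (hd A)],
                 B <- [seq B <- H | Z.ltb (hd B) 0]] in
  simplify (zero ++ mixed).

(** All constraints being homogeneous, the contradictions sought are instances of 0 < 0; [n] counts
    the variables still to be eliminated. *)
Fixpoint infeasible (n : nat) (H : region) : bool :=
  if has (fun A => A.1 && null_form A.2) H then true
  else if n is n'.+1 then infeasible n' (eliminate H) else false.

(** The part of [H] outside [T] is cut into pieces, each satisfying an initial stretch of [T] and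
    violating the next constraint. *)
Fixpoint all_pieces (k : region -> bool) (H T : region) : bool :=
  if T is A :: T' then k (opposite A :: H) && all_pieces k (A :: H) T'
  else true.

(* [covered n H Ts]: the region [H] of an [n]-dimensional space is contained
   in the union of the regions [Ts]. *)
Fixpoint covered (n : nat) (H : region) (Ts : seq region) : bool :=
  if infeasible n H then true
  else if Ts is T :: Ts' then
    if infeasible n (T ++ H) then covered n H Ts'
    else all_pieces (fun H' => covered n H' Ts') H T
  else false.

(** * Soundness of elimination and of coverings *)

Section Engine.
Variable R : numDomainType.
Implicit Types (v : seq R) (f g : seq Z) (A B : constraint) (H T : region).

Lemma zvalD a b : zval R (Z.add a b) = zval R a + zval R b.
Proof. by rewrite /zval [int_of_Z _](rmorphD int_of_Z) rmorphD. Qed.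

Lemma zvalM a b : zval R (Z.mul a b) = zval R a * zval R b.
Proof. by rewrite /zval [int_of_Z _](rmorphM int_of_Z) rmorphM. Qed.

Lemma zvalN a : zval R (Z.opp a) = - zval R a.
Proof. by rewrite /zval [int_of_Z _](rmorphN int_of_Z) rmorphN. Qed.

Lemma zval_gt0 a : Z.ltb 0 a -> 0 < zval R a.
Proof. by case: a => // p _; rewrite /zval /= ltr0n; apply/ssrnat.ltP/Pos2Nat.is_pos. Qed.

Lemma zval_lt0 a : Z.ltb a 0 -> zval R a < 0.
Proof. by case: a => // p _; rewrite /zval ltrz0. Qed.

Lemma lform_scale c f v : lform (map (Z.mul c) f) v = zval R c * lform f v.
Proof.
elim: f v => [|a f IH] [|x v] /=; rewrite ?mulr0// IH mulrDr.
by rewrite zvalM mulrA.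
Qed.

Lemma lform_opp f v : lform (map Z.opp f) v = - lform f v.
Proof.
by elim: f v => [|a f IH] [|x v] /=; rewrite ?oppr0// IH opprD zvalN mulNr.
Qed.

Lemma lform_comb s t f g v :
  lform (lcomb s t f g) v = zval R s * lform f v + zval R t * lform g v.
Proof.
elim: f g v => [|a f IH] g v; first by rewrite /= mulr0 add0r lform_scale.
case: g => [|b g].
  by rewrite [lcomb _ _ _ _](_ : _ = map (Z.mul s) (a :: f))//
    lform_scale /= mulr0 addr0.
case: v => [|x v] /=; first by rewrite !mulr0 addr0.
by rewrite IH zvalD !zvalM !mulrDr mulrDl !mulrA addrACA.
Qed.

Lemma lform0 f v : null_form f -> lform f v = 0.
Proof.
rewrite /null_form; elim: f v => [|a f IH] [|x v] //=.
by case: a => //= /IH->; rewrite mul0r addr0.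
Qed.

Lemma lform_zoom (k : R) f v : lform f [seq k * x | x <- v] = k * lform f v.
Proof.
elim: f v => [|a f IH] [|x v] /=; rewrite ?mulr0// IH mulrDr.
by rewrite mulrCA.
Qed.

Lemma inside_zoom (k : R) H v : 0 < k ->
  inside H [seq k * x | x <- v] = inside H v.
Proof.
move=> k0; apply: eq_all => -[[] f]; rewrite /holds /= lform_zoom.
  by rewrite pmulr_rgt0.
by rewrite pmulr_rge0.
Qed.

Lemma insideC H T v : inside (H ++ T) v = inside H v && inside T v.
Proof. exact: all_cat. Qed.

Lemma inside_simplify H v : inside H v -> inside (simplify H) v.
Proof.
elim: H => //= A H IH /andP[Av /IH Hv]; case: ifP => // _; case: ifP => // _.
by rewrite /inside /= Av.
Qed.

(** A combination with positive multipliers of two valid inequalities, chosen to cancel [x], is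
    valid. Only this direction of the elimination is required. *)
Lemma eliminateP H x v : inside H (x :: v) -> inside (eliminate H) v.
Proof.
move=> /allP h; apply: inside_simplify; rewrite insideC; apply/andP; split.
  apply/allP => _ /mapP[-[s f] + ->]; rewrite mem_filter => /andP[/= + /h].
  case: f => // a f /=; rewrite /holds /=; case: a => //= _.
  by rewrite mul0r add0r.
apply/allP => _ /allpairsP[[[s f] [t g]] /= [+ + ->]]; rewrite !mem_filter.
move=> /andP[/= a0 /h hA] /andP[/= b0 /h hB].
case: f a0 hA => // a f /= /zval_gt0 a0; case: g b0 hB => // b g /= /zval_lt0 b0.
rewrite /holds /= lform_comb zvalN; rewrite -oppr_gt0 in b0.
have -> : - zval R b * lform f v + zval R a * lform g v =
    - zval R b * (zval R a * x + lform f v) +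
      zval R a * (zval R b * x + lform g v).
  have h0 : - zval R b * (zval R a * x) + zval R a * (zval R b * x) = 0.
    by rewrite mulNr mulrCA addNr.
  by rewrite !mulrDr addrACA h0 add0r.
case: s; case: t => /= hA hB.
- by rewrite addr_gt0// mulr_gt0.
- by rewrite ltr_pwDl ?mulr_gt0// mulr_ge0// ltW.
- by rewrite ltr_wpDl ?mulr_gt0// mulr_ge0// ltW.
- by rewrite addr_ge0// mulr_ge0// ltW.
Qed.

Lemma infeasibleP n H v : size v = n -> infeasible n H -> ~~ inside H v.
Proof.
elim: n H v => [|n IH] H v sv /=; case: ifP => [/hasP[A AH /andP[A1 A0]] _|_]//.
- apply/negP => /allP/(_ _ AH).
  by rewrite /holds A1 lform0// ltxx.
- apply/negP => /allP/(_ _ AH).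
  by rewrite /holds A1 lform0// ltxx.
- case: v sv => // x v [sv] /(IH _ _ sv).
  by apply: contra => /eliminateP.
Qed.

End Engine.

Lemma oppositeP (R : realDomainType) (v : seq R) A :
  holds v (opposite A) = ~~ holds v A.
Proof.
by case: A => -[] f; rewrite /holds /= lform_opp ?oppr_ge0 ?oppr_gt0 -?leNgt -?ltNge.
Qed.

Lemma coveredP (R : realDomainType) n H Ts (v : seq R) : size v = n ->
  covered n H Ts -> inside H v -> exists2 T, T \in Ts & inside T v.
Proof.
move=> sv; elim: Ts H => [|T Ts IH] H /=; case: ifP => [/(infeasibleP sv)/negP//|_].
  by [].
case: ifPn => _; first by move=> /IH h /h[T' T'Ts ?]; exists T'; rewrite // inE T'Ts orbT.
(* A point of [H] outside [T] lies in the piece given by the first constraint of [T] that it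
   violates. *)
suff h G : all_pieces (covered n ^~ Ts) H G -> inside H v -> inside G v \/
    exists2 T', T' \in Ts & inside T' v.
  move=> /h{}h /h[Tv|[T' T'Ts ?]]; first by exists T; rewrite // inE eqxx.
  by exists T'; rewrite // inE T'Ts orbT.
elim: G H => [|A G IHG] H /=; first by left.
move=> /andP[/IH k1 /IHG k2] Hv; have [Av|nAv] := boolP (holds v A).
  have /k2[Gv|] : inside (A :: H) v by rewrite /inside /= Av.
    by left.
  by right.
by right; apply: k1; rewrite /inside /= oppositeP nAv.
Qed.

(** * The cells of the natural extension *)

(* Homogeneous coordinates [(|z|^2, Re z, Im z, 1)] of the points of the
   sphere; infinity is [(1, 0, 0, 0)]. *)
Record quad (R : Type) := Quad { qn : R; qx : R; qy : R; qd : R }.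

Definition qseq (R : Type) (v : quad R) := [:: qn v; qx v; qy v; qd v].

(** The closed forward light cone; its nonzero rays are the points of the sphere. *)
Definition null_quad (R : numDomainType) (v : quad R) :=
  [/\ 0 <= qn v, 0 <= qd v & qn v * qd v = qx v ^+ 2 + qy v ^+ 2].

(* [- i z], [z + 1], [z - 1] and [1 / z]. *)
Definition qrot (R : numDomainType) (v : quad R) :=
  Quad (qn v) (qy v) (- qx v) (qd v).
Definition qadd1 (R : numDomainType) (v : quad R) :=
  Quad (qn v + 2 * qx v + qd v) (qx v + qd v) (qy v) (qd v).
Definition qsub1 (R : numDomainType) (v : quad R) :=
  Quad (qn v - 2 * qx v + qd v) (qx v - qd v) (qy v) (qd v).
Definition qinv (R : numDomainType) (v : quad R) :=
  Quad (qd v) (qx v) (- qy v) (qn v).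

(** Forms pull back by the transposed matrix, so regions can be moved symbolically, before any point
    is given. *)
Definition transpose (M : Z -> Z -> Z -> Z -> seq Z) (f : seq Z) : seq Z :=
  M (nth Z0 f 0) (nth Z0 f 1) (nth Z0 f 2) (nth Z0 f 3).
Definition pull_rot := transpose (fun a b c d => [:: a; - c; b; d]%coqZ).
Definition pull_add1 :=
  transpose (fun a b c d => [:: a; 2 * a + b; c; a + b + d]%coqZ).
Definition pull_sub1 :=
  transpose (fun a b c d => [:: a; b - 2 * a; c; a - b + d]%coqZ).
Definition pull_inv := transpose (fun a b c d => [:: d; b; - c; a]%coqZ).

Definition pull (P : seq Z -> seq Z) (H : region) : region :=
  [seq (A.1, P A.2) | A <- H].

Definition ge (n x y d : Z) : constraint := (false, [:: n; x; y; d]).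
Definition gt (n x y d : Z) : constraint := (true, [:: n; x; y; d]).

Arguments ge (n x y d)%_coqZ.
Arguments gt (n x y d)%_coqZ.

Definition re_le := ge 0 (-2) 0 1.       (* Re z <= 1/2 *)
Definition im_le := ge 0 0 (-2) 1.       (* Im z <= 1/2 *)
Definition im_ge := ge 0 0 2 1.          (* Im z >= -1/2 *)
Definition in0 := ge (-1) 0 0 1.         (* |z| <= 1 *)
Definition out0 := ge 1 0 0 (-1).        (* |z| >= 1 *)
Definition out1 := ge 1 (-2) 0 0.        (* |z - 1| >= 1 *)
Definition outi := ge 1 0 (-2) 0.        (* |z - i| >= 1 *)
Definition outNi := ge 1 0 2 0.          (* |z + i| >= 1 *)
Definition out1i := ge 1 (-2) (-2) 1.    (* |z - 1 - i| >= 1 *)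
Definition out1Ni := ge 1 (-2) 2 1.      (* |z - 1 + i| >= 1 *)

(* A set of points [w], and the regions whose union is the fibre over it. *)
Definition cell := (region * seq region)%type.

(* The cells of the sector [-x < y <= x] of the diamond. *)
Definition lens : cell :=
  ([:: gt (-1) 1 1 0; gt (-1) 1 (-1) 0], [:: [:: re_le; out0; outi; outNi]]).
Definition cusp_up : cell :=
  ([:: gt 0 0 1 0; gt 0 1 (-1) 0; gt 0 (-1) (-1) 1; gt 1 (-1) 1 0],
   [:: [:: re_le; out0; outi]]).
Definition cusp_down : cell :=
  ([:: gt 0 0 (-1) 0; gt 0 1 1 0; ge 0 (-1) 1 1; ge 1 (-1) (-1) 0],
   [:: [:: re_le; out0; outNi]]).
Definition inner_arc : cell :=
  ([:: gt 0 0 1 0; ge 1 (-1) 1 0; ge (-1) 1 (-1) 0],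
   [:: [:: re_le; out0; outi; out1Ni]]).
Definition diagonal : cell :=
  ([:: ge 0 1 (-1) 0; ge 0 (-1) 1 0; gt 0 1 0 0; ge 0 (-2) 0 1],
   [:: [:: re_le; im_le; out0]]).
Definition edge : cell :=
  ([:: ge 0 1 1 (-1); ge 0 (-1) (-1) 1; gt 0 2 0 (-1); gt 0 (-1) 0 1],
   [:: [:: re_le; im_le; out0]]).
Definition vertex : cell :=
  ([:: ge 0 1 0 (-1); ge 0 (-1) 0 1; ge 0 0 1 0; ge 0 0 (-1) 0],
   [:: [:: re_le; out1]]).

(* The cells of the sector [-x <= y < x] outside the diamond. *)
Definition strip := [:: re_le; im_le; im_ge; out1].
Definition core : cell := ([:: gt 0 1 1 (-1); gt 0 1 (-1) (-1)], [:: strip]).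
Definition ray_up : cell :=
  ([:: ge 0 1 (-1) (-1); ge 0 (-1) 1 1; gt 0 1 0 (-1)],
   [:: strip; [:: re_le; out0; out1Ni; ge 0 0 (-2) (-1)];
       [:: in0; out1; im_le]]).
Definition ray_down : cell :=
  ([:: ge 0 1 1 (-1); ge 0 (-1) (-1) 1; gt 0 1 0 (-1)],
   [:: strip; [:: in0; out1; ge 0 0 1 0; out1i]]).
Definition strip_up : cell :=
  ([:: gt 0 (-1) 1 1; gt 0 1 (-1) 0; ge 1 (-1) (-1) 0; gt 0 1 1 (-1)],
   [:: [:: re_le; im_le; out1]]).
Definition strip_down : cell :=
  ([:: gt 0 (-1) (-1) 1; gt 0 1 1 0; gt 1 (-1) 1 0; gt 0 1 (-1) (-1)],
   [:: [:: re_le; im_ge; out1]]).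
Definition quarter_up : cell :=
  ([:: gt 0 1 (-1) 0; gt 0 1 1 (-1); gt (-1) 1 1 0],
   [:: [:: re_le; im_le; out0]]).
Definition quarter_down : cell :=
  ([:: ge 0 1 1 0; gt 0 1 (-1) (-1); gt (-1) 1 (-1) 0],
   [:: [:: re_le; im_ge; out0]]).
Definition outer_arc : cell :=
  ([:: ge 1 (-1) 1 0; ge (-1) 1 (-1) 0; gt 0 1 (-1) (-1); gt 0 1 1 0],
   [:: [:: re_le; im_ge; out1; outNi]]).
Definition antidiagonal : cell :=
  ([:: ge 0 1 1 0; ge 0 (-1) (-1) 0; ge 0 1 0 (-1)],
   [:: [:: re_le; im_ge; out1; outNi]]).

Definition inner_cells :=
  [:: lens; cusp_up; cusp_down; inner_arc; diagonal; edge; vertex].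
Definition outer_cells :=
  [:: core; ray_up; ray_down; strip_up; strip_down; quarter_up; quarter_down;
      outer_arc; antidiagonal].
Definition cells := inner_cells ++ outer_cells.

(* Regions of the projective space that do not meet the sphere: outside the
   disk [|z|^2 <= x + y] in its inscribed square, outside the disk
   [2 |z|^2 <= x + y] in its inscribed square, and at nonpositive distance from
   a point. *)
Definition square_voids : seq region :=
  [:: [:: gt 0 0 0 1; ge 0 1 0 0; ge 0 (-1) 0 1; ge 0 0 1 0; ge 0 0 (-1) 1;
          gt 1 (-1) (-1) 0];
      [:: ge 0 1 0 0; ge 0 (-1) 0 1; gt 0 0 1 0; gt 0 0 (-1) 1;
          ge 1 (-1) (-1) 0];
      [:: gt 0 1 0 0; gt 0 (-1) 0 1; ge 0 0 1 0; ge 0 0 (-1) 1;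
          ge 1 (-1) (-1) 0]].
Definition half_square_void : region :=
  [:: gt 0 0 0 1; ge 0 1 0 0; ge 0 (-2) 0 1; ge 0 0 1 0; ge 0 0 (-2) 1;
      gt 2 (-1) (-1) 0].
Definition origin_void : region := [:: ge (-1) 0 0 0; gt 0 1 0 0].
Definition one_voids : seq region :=
  [:: [:: ge (-1) 2 0 (-1); gt 0 0 1 0]; [:: ge (-1) 2 0 (-1); gt 0 0 (-1) 0];
      [:: ge (-1) 2 0 (-1); gt 0 1 0 (-1)];
      [:: ge (-1) 2 0 (-1); gt 0 (-1) 0 1]].
Definition one_void : region := [:: gt (-1) 2 0 (-1)].
Definition corner_void : region := [:: gt (-1) 2 (-2) (-2)].

Definition rotations (T : seq region) : seq region :=
  flatten [seq map (iter k (pull pull_rot)) T | k <- iota 0 4].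

Definition voids : seq region :=
  rotations [:: origin_void] ++ one_voids ++ rotations square_voids ++
  one_void :: rotations [:: half_square_void; corner_void].

Definition fibre_voids := rotations [:: half_square_void].

Definition finite_pt := [:: ge 1 0 0 0; gt 0 0 0 1].
Definition sphere_pt := [:: ge 1 0 0 0; ge 0 0 0 1].

(** * Finite certificates for F(D) = D *)

Definition fibre_into (P : seq Z -> seq Z) (c c' : cell) :=
  all (fun r => covered 4 (sphere_pt ++ r)
    (fibre_voids ++ [seq pull P r' | r' <- c'.2])) c.2.

Definition shifted (k : nat) (f : seq Z) := pull_sub1 (iter k pull_rot f).

(** Target cells are found by search: a rotated cell qualifies when its fibre contains the whole
    translated fibre. It then remains to check that the qualifying cells cover the translate of
    [c.1]. *)
Definition image_of_translation (c : cell) : seq (nat * cell) :=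
  [seq q <- [seq (k, c') | k <- iota 0 4, c' <- cells] |
    if infeasible 4 (pull (shifted q.1) q.2.1 ++ finite_pt ++ c.1) then false
    else fibre_into (shifted q.1) c q.2].

Definition translation_check : bool :=
  all (fun c => covered 4 (finite_pt ++ c.1)
    ([seq pull pull_sub1 T | T <- rotations square_voids] ++
     [seq pull (shifted q.1) q.2.1 | q <- image_of_translation c])) outer_cells.

Definition image_of_inversion (c : cell) : seq cell :=
  [seq c' <- cells |
    if infeasible 4 (pull pull_inv c'.1 ++ finite_pt ++ c.1) then false
    else fibre_into pull_inv c c'].

Definition inversion_check : bool :=
  all (fun c => covered 4 (finite_pt ++ c.1)
    (one_void :: rotations (half_square_void :: square_voids) ++
     [seq pull pull_inv c'.1 | c' <- image_of_inversion c])) inner_cells.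

(* [Some k] is [z |-> (-i)^k z + 1], and [None] is [z |-> 1/z]. *)
Definition pull_move (k : option nat) (f : seq Z) : seq Z :=
  if k is Some k then iter k pull_rot (pull_add1 f) else pull_inv f.

(** A move qualifies only if it takes the whole of [H] into one cell, so that over every point of
    [H] the pulled-back fibres of all qualifying cells are available at once. *)
Definition preimages (H : region) : seq (option nat * cell) :=
  [seq q <- [seq (Some k, c) | k <- iota 0 4, c <- outer_cells] ++
            [seq (None, c) | c <- inner_cells] |
    let T := pull (pull_move q.1) q.2.1 in
    if infeasible 4 (T ++ H) then false else covered 4 H (voids ++ [:: T])].

(** [quarter_down] meets the line x + y = 0, and there the preimage i w + 1 passes from [strip_up]
    to [ray_up]. The split by the sign of x + y separates the two cases. *)
Definition preimage_check : bool :=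
  all (fun c => all (fun A =>
    let H := A :: finite_pt ++ c.1 in
    if infeasible 4 H then true else
    let Q := preimages H in
    all (fun r => covered 4 (sphere_pt ++ r) (fibre_voids ++
      flatten [seq [seq pull (pull_move q.1) r' | r' <- q.2.2] | q <- Q])) c.2)
    [:: gt 0 1 1 0; ge 0 (-1) (-1) 0]) cells.

Arguments Z.add : simpl never.
Arguments Z.mul : simpl never.
Arguments Z.opp : simpl never.
Arguments Z.sub : simpl never.

(** * The moves, on forms and on the light cone *)

Section Quads.
Variable R : realType.
Implicit Types (u v w : quad R) (T H : region) (f : seq Z).

Lemma lform_quad f (n x y d : R) : lform f [:: n; x; y; d] =
  zval R (nth Z0 f 0) * n + zval R (nth Z0 f 1) * x +
  zval R (nth Z0 f 2) * y + zval R (nth Z0 f 3) * d.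
Proof.
have z0 a : zval R Z0 * a = 0 by rewrite /zval mul0r.
by case: f => [|a [|b [|c [|e [|? f]]]]] /=; rewrite ?z0 ?addr0 ?addrA.
Qed.

Lemma zval0 : zval R 0%coqZ = 0. Proof. by []. Qed.
Lemma zval1 : zval R 1%coqZ = 1. Proof. by []. Qed.
Lemma zval2 : zval R 2%coqZ = 2. Proof. by []. Qed.
Lemma zvalN1 : zval R (-1)%coqZ = -1. Proof. by []. Qed.
Lemma zvalN2 : zval R (-2)%coqZ = - 2. Proof. by []. Qed.
Definition zvals := (zval0, zval1, zval2, zvalN1, zvalN2).

Definition adjoint (P : seq Z -> seq Z) (M : quad R -> quad R) :=
  forall f v, lform (P f) (qseq v) = lform f (qseq (M v)).

Lemma adjoint_rot : adjoint pull_rot (@qrot R).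
Proof. by move=> f v; rewrite /qseq !lform_quad /= zvalN; ring. Qed.

Lemma adjoint_add1 : adjoint pull_add1 (@qadd1 R).
Proof. by move=> f v; rewrite /qseq !lform_quad /= !zvalD zvalM zval2; ring. Qed.

Lemma adjoint_sub1 : adjoint pull_sub1 (@qsub1 R).
Proof.
by move=> f v; rewrite /qseq !lform_quad /= /Z.sub !zvalD !zvalN zvalM zval2; ring.
Qed.

Lemma adjoint_inv : adjoint pull_inv (@qinv R).
Proof. by move=> f v; rewrite /qseq !lform_quad /= zvalN; ring. Qed.

Lemma adjoint_comp P Q M N : adjoint P M -> adjoint Q N ->
  adjoint (P \o Q) (N \o M).
Proof. by move=> hP hQ f v; rewrite /= hP hQ. Qed.

Lemma adjoint_iter P M k : adjoint P M -> adjoint (iter k P) (iter k M).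
Proof.
move=> hP; elim: k => [|k IH] f v //.
by rewrite iterSr [RHS]/= -hP -IH.
Qed.

Lemma inside_pull P M H v : adjoint P M ->
  inside (pull P H) (qseq v) = inside H (qseq (M v)).
Proof.
move=> hP; rewrite /inside all_map; apply: eq_all => -[s f].
by rewrite /holds /= hP.
Qed.

Lemma null_rot v : null_quad v -> null_quad (qrot v).
Proof. by move=> [? ? h]; split=> //=; rewrite h sqrrN addrC. Qed.

Lemma null_iter_rot k v : null_quad v -> null_quad (iter k (@qrot R) v).
Proof. by elim: k => //= k IH /IH /null_rot. Qed.

Lemma qd_iter_rot k v : qd (iter k (@qrot R) v) = qd v.
Proof. by elim: k. Qed.

Lemma null_sub1 v : null_quad v -> null_quad (qsub1 v).
Proof.
case: v => n x y d [/= n0 d0 h]; split=> //=; last by rewrite mulrDl mulrBl h; ring.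
(* When d = 0 the cone forces x = 0; otherwise multiplying by d exhibits a sum of squares. *)
have [d1|d1] := ltrP 0 d; last first.
  have {d0 d1} d1 : d = 0 by apply/eqP; rewrite eq_le d1.
  rewrite d1 mulr0 in h; have : x ^+ 2 <= 0 by rewrite h lerDl sqr_ge0.
  by rewrite -[x ^+ 2 <= 0]andbT -(sqr_ge0 x) -eq_le sqrf_eq0 => /eqP->; lra.
rewrite -(pmulr_lge0 _ d1).
have -> : (n - 2 * x + d) * d = (x - d) ^+ 2 + y ^+ 2 by rewrite mulrDl mulrBl h; ring.
by rewrite addr_ge0// sqr_ge0.
Qed.

Definition vacant T := forall v, null_quad v -> ~~ inside T (qseq v).

Lemma void_sub1 T : vacant T -> vacant (pull pull_sub1 T).
Proof.
by move=> hT v /null_sub1/hT; rewrite (inside_pull _ _ adjoint_sub1).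
Qed.

Lemma iter_pull k P H : iter k (pull P) H = pull (iter k P) H.
Proof.
elim: k => [|k IH] /=; first by rewrite /pull -[LHS]map_id; apply: eq_map; case.
by rewrite IH /pull -map_comp.
Qed.

Lemma void_rotations Ts : {in Ts, forall T, vacant T} ->
  {in rotations Ts, forall T, vacant T}.
Proof.
move=> h T /flattenP[_ /mapP[k _ ->] /mapP[T' /h hT ->]] v v0.
rewrite iter_pull (inside_pull _ _ (adjoint_iter k adjoint_rot)).
exact/hT/null_iter_rot.
Qed.

End Quads.

Ltac unpack := repeat match goal with
  | H : is_true (_ && _) |- _ => move/andP: H => [? ?]
  end.

Ltac conditions := rewrite /inside /holds /= ?zvals => ?; unpack.

(** * Regions that the light cone misses; evaluation of the certificates *)

Section Voids.
Variable R : realType.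
Implicit Types v w : quad R.

(** In the square 0 <= x, y <= d one has x^2 <= x d and y^2 <= y d, whence n d <= (x + y) d. The
    three variants differ in which of the inequalities is strict. *)
Lemma void_square : {in square_voids, forall T, vacant R T}.
Proof.
move=> T; rewrite !inE => /or3P[] /eqP-> [n x y d] [/= n0 d0 h];
  apply/negP; conditions.
- have h1 : 0 <= x * (d - x) by apply: mulr_ge0; lra.
  have h2 : 0 <= y * (d - y) by apply: mulr_ge0; lra.
  have h3 : 0 < (n - x - y) * d by apply: mulr_gt0; lra.
  by lra.
- have h1 : 0 <= x * (d - x) by apply: mulr_ge0; lra.
  have h2 : 0 < y * (d - y) by apply: mulr_gt0; lra.
  have h3 : 0 <= (n - x - y) * d by apply: mulr_ge0; lra.
  by lra.
- have h1 : 0 < x * (d - x) by apply: mulr_gt0; lra.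
  have h2 : 0 <= y * (d - y) by apply: mulr_ge0; lra.
  have h3 : 0 <= (n - x - y) * d by apply: mulr_ge0; lra.
  by lra.
Qed.

Lemma void_half_square : vacant R half_square_void.
Proof.
move=> [n x y d] [/= n0 d0 h]; apply/negP; conditions.
have h1 : 0 <= x * (d - 2 * x) by apply: mulr_ge0; lra.
have h2 : 0 <= y * (d - 2 * y) by apply: mulr_ge0; lra.
have h3 : 0 < (2 * n - x - y) * d by apply: mulr_gt0; lra.
by lra.
Qed.

Lemma null_quad_origin v : null_quad v -> qn v <= 0 -> qx v = 0 /\ qy v = 0.
Proof.
case: v => n x y d [/= n0 d0 h] n1; have /eqP nE : n == 0 by rewrite eq_le n1.
move: h; rewrite nE mul0r => /esym/eqP.
by rewrite paddr_eq0 ?sqr_ge0// !sqrf_eq0 => /andP[/eqP-> /eqP->].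
Qed.

Lemma void_origin : vacant R origin_void.
Proof.
move=> v /null_quad_origin; case: v => n x y d /= h; apply/negP; conditions.
have [|] := h; lra.
Qed.

Lemma void_one : {in one_voids, forall T, vacant R T}.
Proof.
move=> T; rewrite !inE => /or4P[] /eqP-> v /null_sub1/null_quad_origin;
  case: v => n x y d /= h; apply/negP; conditions; have [|] := h; lra.
Qed.

Lemma void_one_strict : vacant R one_void.
Proof.
move=> v /null_sub1[]; case: v => n x y d /= h _ _; apply/negP; conditions.
by lra.
Qed.

(** The map z |-> i (z - 1) - 1 takes 1 - i to 0, so the form is minus the squared distance to that
    corner. *)
Lemma void_corner : vacant R corner_void.
Proof.
move=> v /null_sub1/(null_iter_rot 3)/null_sub1[]; case: v => n x y d /= h _ _.
by apply/negP; conditions; lra.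
Qed.

Lemma void_cat (Ts Us : seq region) : {in Ts, forall T, vacant R T} ->
  {in Us, forall T, vacant R T} -> {in Ts ++ Us, forall T, vacant R T}.
Proof. by move=> h1 h2 T; rewrite mem_cat => /orP[/h1|/h2]. Qed.

Lemma void_seq1 T : vacant R T -> {in [:: T], forall T, vacant R T}.
Proof. by move=> h S; rewrite inE => /eqP->. Qed.

Lemma voidsP : {in voids, forall T, vacant R T}.
Proof.
apply: void_cat; first exact: void_rotations (void_seq1 void_origin).
apply: void_cat void_one _.
apply: void_cat; first exact: void_rotations void_square.
apply: (void_cat (Ts := [:: _])); first exact: void_seq1 void_one_strict.
apply/void_rotations/(void_cat (Ts := [:: _])); apply: void_seq1.
  exact: void_half_square.
exact: void_corner.
Qed.

Lemma fibre_voidsP : {in fibre_voids, forall T, vacant R T}.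
Proof. exact: void_rotations (void_seq1 void_half_square). Qed.

Lemma coveredVP H Vs Ts v : {in Vs, forall T, vacant R T} ->
  covered 4 H (Vs ++ Ts) -> null_quad v -> inside H (qseq v) ->
  exists2 T, T \in Ts & inside T (qseq v).
Proof.
move=> hV hH v0 /(coveredP (v := qseq v) erefl hH)[T + Tv].
rewrite mem_cat => /orP[/hV/(_ v v0)|TTs]; first by rewrite Tv.
by exists T.
Qed.

Lemma translation_checkT : translation_check.
Proof. by vm_compute. Qed.

Lemma inversion_checkT : inversion_check.
Proof. by vm_compute. Qed.

Lemma preimage_checkT : preimage_check.
Proof. by vm_compute. Qed.

Definition in_fibre (c : cell) v := has (fun r => inside r (qseq v)) c.2.

Lemma finite_ptE v : null_quad v -> inside finite_pt (qseq v) = (0 < qd v).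
Proof.
by move=> [n0 _ _]; rewrite /inside /holds /= !zvals; apply/idP/idP => [/and3P[]|?];
  rewrite ?andbT; [lra | apply/andP; split; lra].
Qed.

Lemma sphere_ptT v : null_quad v -> inside sphere_pt (qseq v).
Proof.
by move=> [n0 d0 _]; rewrite /inside /holds /= !zvals andbT; apply/andP; split; lra.
Qed.

Lemma fibre_intoP P M c c' v : adjoint P M -> fibre_into P c c' ->
  null_quad v -> in_fibre c v -> in_fibre c' (M v).
Proof.
move=> hP /allP h v0 /hasP[r /h{}h rv].
have [|T /mapP[r' r'c ->]] := coveredVP fibre_voidsP h v0.
  by rewrite insideC sphere_ptT.
by rewrite (inside_pull _ _ hP) => ?; apply/hasP; exists r'.
Qed.

Lemma adjoint_shifted k : adjoint (shifted k) (iter k (@qrot R) \o @qsub1 R).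
Proof. exact: adjoint_comp (@adjoint_sub1 R) (adjoint_iter k (@adjoint_rot R)). Qed.

Lemma forward_translation c v w : c \in outer_cells -> null_quad v ->
    null_quad w -> 0 < qd w -> inside c.1 (qseq w) -> in_fibre c v ->
  exists k c', [/\ (k < 4)%N, c' \in cells,
    inside c'.1 (qseq (iter k (@qrot R) (qsub1 w))) &
    in_fibre c' (iter k (@qrot R) (qsub1 v))].
Proof.
move=> cO v0 w0 d0 wc vc; have /allP/(_ _ cO) h := translation_checkT.
have [||T /mapP[[k c'] + ->]] := coveredVP _ h w0.
- move=> _ /mapP[T TV ->]; apply: void_sub1.
  exact: void_rotations void_square _ TV.
- by rewrite insideC finite_ptE// d0.
rewrite mem_filter => /andP[ck /allpairsP[q [+ + [kE cE]]]].
rewrite -{}kE -{}cE mem_iota add0n => k4 c'c.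
rewrite (inside_pull _ _ (adjoint_shifted k)) /= => wc'.
exists k, c'; split=> //; move: ck; case: ifP => // _ hF.
exact: fibre_intoP (adjoint_shifted k) hF v0 vc.
Qed.

Lemma forward_inversion c v w : c \in inner_cells -> null_quad v ->
    null_quad w -> 0 < qd w -> inside c.1 (qseq w) -> in_fibre c v ->
  exists c', [/\ c' \in cells, inside c'.1 (qseq (qinv w)) &
    in_fibre c' (qinv v)].
Proof.
move=> cI v0 w0 d0 wc vc; have /allP/(_ _ cI) h := inversion_checkT.
rewrite -cat_cons in h.
have [||T /mapP[c' + ->]] := coveredVP _ h w0.
- apply: (void_cat (Ts := [:: _])); first exact: void_seq1 void_one_strict.
  apply/void_rotations/(void_cat (Ts := [:: _])) => //.
    exact: void_seq1 void_half_square.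
  exact: void_square.
- by rewrite insideC finite_ptE// d0.
rewrite mem_filter (inside_pull _ _ (@adjoint_inv R)) => /andP[ck c'c] wc'.
exists c'; split=> //; move: ck; case: ifP => // _ hF.
exact: fibre_intoP (@adjoint_inv R) hF v0 vc.
Qed.

Definition move_quad (k : option nat) v :=
  if k is Some k then qadd1 (iter k (@qrot R) v) else qinv v.

Lemma adjoint_move k : adjoint (pull_move k) (move_quad k).
Proof.
case: k => [k|]; last exact: adjoint_inv.
exact: adjoint_comp (adjoint_iter k (@adjoint_rot R)) (@adjoint_add1 R).
Qed.

Lemma backward_move c v w : c \in cells -> null_quad v ->
    null_quad w -> 0 < qd w -> inside c.1 (qseq w) -> in_fibre c v ->
  exists k c', [/\ if k is Some k then (k < 4)%N && (c' \in outer_cells)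
                   else c' \in inner_cells,
    inside c'.1 (qseq (move_quad k w)) & in_fibre c' (move_quad k v)].
Proof.
move=> cC v0 w0 d0 wc /hasP[r rc rv].
have /allP/(_ _ cC)/allP hA := preimage_checkT.
have [A AL wA] : exists2 A, A \in [:: gt 0 1 1 0; ge 0 (-1) (-1) 0] &
    holds (qseq w) A.
  have [A1|A1] := boolP (holds (qseq w) (gt 0 1 1 0)).
    by exists (gt 0 1 1 0) => //; rewrite inE eqxx.
  exists (ge 0 (-1) (-1) 0); first by rewrite !inE eqxx orbT.
  by have := oppositeP (qseq w) (gt 0 1 1 0); rewrite A1.
have wH : inside (A :: finite_pt ++ c.1) (qseq w).
  by rewrite -cat1s !insideC finite_ptE// d0 wc /inside /= wA.
move: (hA _ AL); cbv beta zeta.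
case: ifP => [/(infeasibleP (v := qseq w) erefl)|_]; first by rewrite wH.
move=> /allP/(_ _ rc) h.
have [|T /flattenP[_ /mapP[[k c'] + ->] /mapP[r' r'c ->]]] :=
  coveredVP fibre_voidsP h v0.
  by rewrite insideC sphere_ptT.
rewrite mem_filter (inside_pull _ _ (adjoint_move k)) => /andP[+ kc'] vr'.
cbv beta zeta; case: ifP => // _ hw.
have [|T'] := coveredVP voidsP hw w0; first by [].
rewrite inE => /eqP->; rewrite (inside_pull _ _ (adjoint_move k)) => wc'.
exists k, c'; split=> //; last by apply/hasP; exists r'.
move: kc'; rewrite mem_cat => /orP[/allpairsP[q [+ + [-> ->]]]|].
  by rewrite mem_iota add0n => /andP[_ ->] ->.
by move=> /mapP[c'' ? [-> ->]].
Qed.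

End Voids.

(** * The map [f_diamond] in homogeneous coordinates *)

Lemma normc_gt0 (R : realType) (z : Cplx R) : z != 0 -> 0 < Normc.normc z.
Proof.
case: z => x y z0 /=; rewrite sqrtr_gt0 lt_neqAle addr_ge0 ?sqr_ge0// andbT.
rewrite eq_sym paddr_eq0 ?sqr_ge0// !sqrf_eq0.
by apply: contra z0 => /andP[/eqP-> /eqP->].
Qed.

Section Branches.
Variable R : realType.
Implicit Types t : R.

Lemma cos_lt0_pihalf t : pi / 2 < t < 3 * pi / 2 -> cos t < 0.
Proof.
move=> /andP[t1 t2]; have := @cosDpi R (t - pi); rewrite subrK => ->.
by rewrite oppr_lt0 cos_gt0_pihalf//; apply/andP; split; lra.
Qed.

Lemma cos_le0_pihalf t : pi / 2 <= t <= 3 * pi / 2 -> cos t <= 0.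
Proof.
move=> /andP[t1 t2]; have := @cosDpi R (t - pi); rewrite subrK => ->.
by rewrite oppr_le0 cos_ge0_pihalf//; apply/andP; split; lra.
Qed.

Lemma cos_piquarter_gt0 : 0 < cos (pi / 4 : R).
Proof. by rewrite cos_gt0_pihalf//; have := pi_gt0 R; lra. Qed.

Lemma sin_piquarter : sin (pi / 4) = cos (pi / 4 : R).
Proof.
by rewrite -cosBpihalf -[RHS]cosN; congr cos; lra.
Qed.

Lemma cosBsinE t : cos (t + pi / 4) = cos (pi / 4) * (cos t - sin t).
Proof. by rewrite cosD sin_piquarter; ring. Qed.

Lemma cosDsinE t : cos (t - pi / 4) = cos (pi / 4) * (cos t + sin t).
Proof. by rewrite cosB sin_piquarter; ring. Qed.

Variable w : Cplx R.
Hypothesis w_out : ~~ Phi_diamond w.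
Let x := complex.Re w.
Let y := complex.Im w.
Let t := arg w.
Let r := Normc.normc w.

Let w_neq0 : w != 0.
Proof.
apply/negP => /eqP w0; move/negP: w_out; apply.
by rewrite w0 /Phi_diamond /= normr0 addr0 ler01.
Qed.

Let r_gt0 : 0 < r. Proof. exact: normc_gt0. Qed.

Let t_gt : - pi < t. Proof. by have [] := argP w_neq0. Qed.
Let t_le : t <= pi. Proof. by have [] := argP w_neq0. Qed.
Let pi0 : 0 < pi :> R. Proof. exact: pi_gt0. Qed.

(** By the addition formula cos (t + pi / 4) is a positive multiple of x - y, so comparing x and y
    tells on which half circle t lies. [xDy] does the same with x + y. *)
Let xBy : (0 < cos (t + pi / 4)) = (y < x) /\ (0 <= cos (t + pi / 4)) = (y <= x).
Proof.
have [_ _ xE yE] := argP w_neq0.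
have -> : cos (t + pi / 4) = cos (pi / 4) / r * (x - y).
  rewrite cosBsinE /x /y xE yE -/r -/t -mulrBr mulrA mulfVK//.
  by rewrite gt_eqF.
have h : 0 < cos (pi / 4) / r by rewrite divr_gt0// cos_piquarter_gt0.
by rewrite pmulr_rgt0// pmulr_rge0// subr_gt0 subr_ge0.
Qed.

Let xDy : (0 < cos (t - pi / 4)) = (- y < x) /\ (0 <= cos (t - pi / 4)) = (- y <= x).
Proof.
have [_ _ xE yE] := argP w_neq0.
have -> : cos (t - pi / 4) = cos (pi / 4) / r * (x + y).
  rewrite cosDsinE /x /y xE yE -/r -/t -mulrDr mulrA mulfVK//.
  by rewrite gt_eqF.
have h : 0 < cos (pi / 4) / r by rewrite divr_gt0// cos_piquarter_gt0.
by rewrite pmulr_rgt0// pmulr_rge0// -ltrBlDr -lerBlDr sub0r.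
Qed.

(** The two cosines change sign at different quarters, so outside the claimed quarter turn at least
    one of them has the wrong sign. The other three branches go the same way. *)
Lemma branchTV : - x <= y -> y < x -> branch w = genTV.
Proof.
move=> h1 h2; rewrite /branch (negbTE w_out) -/t.
have [h3 h4 h5] := And3 t_gt t_le pi0.
have d1 : 0 < cos (t + pi / 4) by rewrite xBy.1.
have s1 : 0 <= cos (t - pi / 4) by rewrite xDy.2 lerNl.
suff -> : (- (pi / 4) <= t) && (t < pi / 4) by [].
rewrite leNgt ltNge; apply/andP; split; apply/negP => t1.
  have [t2|t2] := lerP t (- (3 * pi / 4)).
    have : cos (t + pi / 4) <= 0.
      by rewrite -cosN cos_le0_pihalf//; apply/andP; split; lra.
    by lra.
  have : cos (t - pi / 4) < 0.
    by rewrite -cosN cos_lt0_pihalf//; apply/andP; split; lra.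
  by lra.
have : cos (t + pi / 4) <= 0.
  by rewrite cos_le0_pihalf//; apply/andP; split; lra.
by lra.
Qed.

Lemma branchUV : - y < x -> x <= y -> branch w = genUV.
Proof.
move=> h1 h2; rewrite /branch (negbTE w_out) -/t.
have [h3 h4 h5] := And3 t_gt t_le pi0.
have d1 : ~~ (0 < cos (t + pi / 4)) by rewrite xBy.1 -leNgt.
have s1 : 0 < cos (t - pi / 4) by rewrite xDy.1.
have t1 : pi / 4 <= t.
  rewrite leNgt; apply/negP => t1; move/negP: d1; apply.
  have [t2|t2] := lerP t (- (3 * pi / 4)); last first.
    by rewrite cos_gt0_pihalf//; apply/andP; split; lra.
  have : cos (t - pi / 4) < 0.
    by rewrite -cosN cos_lt0_pihalf//; apply/andP; split; lra.
  by lra.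
have t2 : t < 3 * pi / 4.
  rewrite ltNge; apply/negP => t2.
  have : cos (t - pi / 4) <= 0.
    by rewrite cos_le0_pihalf//; apply/andP; split; lra.
  by lra.
by rewrite (ltNge t (pi / 4)) t1 andbF t2.
Qed.

Lemma branchT : x < y -> y <= - x -> branch w = genT.
Proof.
move=> h1 h2; rewrite /branch (negbTE w_out) -/t.
have [h3 h4 h5] := And3 t_gt t_le pi0.
have d1 : ~~ (0 <= cos (t + pi / 4)) by rewrite xBy.2 -ltNge.
have s1 : ~~ (0 < cos (t - pi / 4)) by rewrite xDy.1 -leNgt lerNr.
have [t1|t1] := lerP (3 * pi / 4) t; last first.
  have t2 : t < - (3 * pi / 4).
    rewrite ltNge; apply/negP => t2.
    have [t3|t3] := lerP t (pi / 4).
      move/negP: d1; apply; rewrite cos_ge0_pihalf//.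
      by apply/andP; split; lra.
    move/negP: s1; apply; rewrite cos_gt0_pihalf//.
    by apply/andP; split; lra.
  have -> : (- (pi / 4) <= t) = false by apply/negbTE; rewrite -ltNge; lra.
  have -> : (pi / 4 <= t) = false by apply/negbTE; rewrite -ltNge; lra.
  by rewrite t2 orbT.
have -> : (t < pi / 4) = false by apply/negbTE; rewrite -leNgt; lra.
by rewrite !andbF.
Qed.

Lemma branchU : y <= x -> x < - y -> branch w = genU.
Proof.
move=> h1 h2; rewrite /branch (negbTE w_out) -/t.
have [h3 h4 h5] := And3 t_gt t_le pi0.
have d1 : 0 <= cos (t + pi / 4) by rewrite xBy.2.
have s1 : ~~ (0 <= cos (t - pi / 4)) by rewrite xDy.2 -ltNge.
have t1 : - (3 * pi / 4) <= t.
  rewrite leNgt; apply/negP => t1.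
  have : cos (t + pi / 4) < 0.
    by rewrite -cosN cos_lt0_pihalf//; apply/andP; split; lra.
  by lra.
have t2 : t < - (pi / 4).
  rewrite ltNge; apply/negP => t2.
  have [t3|t3] := lerP t (3 * pi / 4).
    move/negP: s1; apply; rewrite cos_ge0_pihalf//.
    by apply/andP; split; lra.
  have : cos (t + pi / 4) < 0.
    by rewrite cos_lt0_pihalf//; apply/andP; split; lra.
  by lra.
have -> : (- (pi / 4) <= t) = false by apply/negbTE; rewrite -ltNge; lra.
have -> : (pi / 4 <= t) = false by apply/negbTE; rewrite -ltNge; lra.
have -> : (3 * pi / 4 <= t) = false by apply/negbTE; rewrite -ltNge; lra.
by have -> : (t < - (3 * pi / 4)) = false by apply/negbTE; rewrite -leNgt.
Qed.

End Branches.

Definition qpoint (R : realType) (w : Cplx R) : quad R :=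
  let x := complex.Re w in let y := complex.Im w in
  Quad (x ^+ 2 + y ^+ 2) x y 1.

Definition qsphere (R : realType) (z : sphere R) : quad R :=
  if z is Some w then qpoint w else Quad 1 0 0 0.

Definition qscale (R : numDomainType) (s : R) (v : quad R) :=
  Quad (s * qn v) (s * qx v) (s * qy v) (s * qd v).

(* Sector [k] is [i^k] times the sector [-x <= y < x]. *)
Definition sector_gen (k : nat) : generator :=
  match (k %% 4)%N with 0 => genTV | 1 => genUV | 2 => genT | _ => genU end.

Definition in_diamond_check : bool :=
  all (fun c : cell => covered 4 (finite_pt ++ c.1) (voids ++
    [:: [:: ge 0 1 1 1; ge 0 1 (-1) 1; ge 0 (-1) 1 1; ge 0 (-1) (-1) 1;
            gt 1 0 0 0]])) inner_cells.

(** In the sector -x <= y < x leaving the diamond means x + |y| > 1, which is not a conjunction of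
    linear inequalities; the two regions are the cases of the absolute value. *)
Definition out_diamond_check : bool :=
  all (fun c : cell => covered 4 (finite_pt ++ c.1) (voids ++
    [:: [:: ge 0 1 1 0; gt 0 1 (-1) 0; gt 0 1 1 (-1)];
        [:: ge 0 1 1 0; gt 0 1 (-1) 0; gt 0 1 (-1) (-1)]])) outer_cells.

Lemma in_diamond_checkT : in_diamond_check.
Proof. by vm_compute. Qed.

Lemma out_diamond_checkT : out_diamond_check.
Proof. by vm_compute. Qed.

Section NaturalExtension.
Variable R : realType.
Implicit Types (w : Cplx R) (z : sphere R) (v : quad R).

Lemma null_qpoint w : null_quad (qpoint w).
Proof. by split=> //=; rewrite ?mulr1// addr_ge0// sqr_ge0. Qed.

Lemma null_qsphere z : null_quad (qsphere z).
Proof.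
by case: z => [w|]; [exact: null_qpoint | split; rewrite //= expr0n /= addr0 mulr0].
Qed.

Lemma iter_rot4 v : iter 4 (@qrot R) v = v.
Proof. by case: v => n x y d; rewrite /= /qrot /= !opprK. Qed.

Lemma iter_rot_mod k v : iter k (@qrot R) v = iter (k %% 4) (@qrot R) v.
Proof.
rewrite {1}(divn_eq k 4) addnC iterD; congr iter.
by elim: (k %/ 4)%N => // j IH; rewrite mulSn iterD IH iter_rot4.
Qed.

Lemma mod4_cases k : [\/ (k %% 4 = 0)%N, (k %% 4 = 1)%N, (k %% 4 = 2)%N |
  (k %% 4 = 3)%N].
Proof.
have : (k %% 4 < 4)%N by rewrite ltn_mod.
case: (k %% 4)%N => [|[|[|[|//]]]] _;
  [exact: Or41 | exact: Or42 | exact: Or43 | exact: Or44].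
Qed.

Lemma branch_outer k (c : cell) w : c \in outer_cells ->
  inside c.1 (qseq (iter k (@qrot R) (qpoint w))) -> branch w = sector_gen k.
Proof.
move=> cO wc; have /allP/(_ _ cO) h := out_diamond_checkT.
have w0 := null_iter_rot k (null_qpoint w).
have [|T TT Tw] := coveredVP (@voidsP R) h w0.
  by rewrite insideC finite_ptE// qd_iter_rot ltr01.
have : [/\ 0 <= qx (iter k (@qrot R) (qpoint w)) + qy (iter k (@qrot R) (qpoint w)),
    0 < qx (iter k (@qrot R) (qpoint w)) - qy (iter k (@qrot R) (qpoint w)) &
    1 < `|qx (iter k (@qrot R) (qpoint w))| + `|qy (iter k (@qrot R) (qpoint w))|].
  move: TT Tw; set v := iter _ _ _; have d1 : qd v = 1 by rewrite qd_iter_rot.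
  have [? ?] := (ler_norm (qx v), ler_norm (qy v)).
  have ? : - qy v <= `|qy v| by rewrite -normrN ler_norm.
  by rewrite !inE => /orP[] /eqP->; conditions; split; lra.
have phi : 1 < `|complex.Re w| + `|complex.Im w| -> ~~ Phi_diamond w.
  by rewrite /Phi_diamond -ltNge.
rewrite iter_rot_mod /sector_gen.
have [] := mod4_cases k => -> /= [h1 h2 h3];
  have {}h3 : ~~ Phi_diamond w by
    apply: phi; move: h3; rewrite ?opprK ?normrN// addrC.
- by apply: branchTV => //; lra.
- by apply: branchUV => //; lra.
- by apply: branchT => //; lra.
- by apply: branchU => //; lra.
Qed.

Lemma branch_inner k (c : cell) w : c \in inner_cells ->
  inside c.1 (qseq (iter k (@qrot R) (qpoint w))) ->
  branch w = genS /\ w <> 0.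
Proof.
move=> cI wc; have /allP/(_ _ cI) h := in_diamond_checkT.
have w0 := null_iter_rot k (null_qpoint w).
have [|T] := coveredVP (@voidsP R) h w0.
  by rewrite insideC finite_ptE// qd_iter_rot ltr01.
rewrite inE => /eqP-> Tw.
have [h1 h2] : `|qx (iter k (@qrot R) (qpoint w))| +
    `|qy (iter k (@qrot R) (qpoint w))| <= 1 /\
    0 < qn (iter k (@qrot R) (qpoint w)).
  move: Tw; set v := iter _ _ _; have d1 : qd v = 1 by rewrite qd_iter_rot.
  conditions; split; last by lra.
  by case: (ltrgt0P (qx v)); case: (ltrgt0P (qy v)); lra.
have {}h1 : Phi_diamond w.
  move: h1; rewrite iter_rot_mod /Phi_diamond.
  by have [] := mod4_cases k => -> /=; rewrite ?opprK ?normrN// addrC.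
split; first by rewrite /branch h1.
move=> w1; move: h2; rewrite iter_rot_mod w1.
by have [] := mod4_cases k => -> /=; rewrite expr0n addr0 ltxx.
Qed.

(** Turning sector [k] onto the standard one conjugates its generator to z |-> z - 1, whence a
    single translation in all the checks. *)
Lemma qpoint_mobius k w : iter k (@qrot R) (qpoint (mobius (sector_gen k) w)) =
  qsub1 (iter k (@qrot R) (qpoint w)).
Proof.
case: w => x y; rewrite [LHS]iter_rot_mod [in RHS]iter_rot_mod /sector_gen.
have e : x +i* y - 1 = (x - 1) +i* y :> Cplx R.
  by apply/eqP; rewrite eq_complex /= oppr0 addr0 !eqxx.
by have [] := mod4_cases k => -> /=; rewrite ?e /qsub1 /qrot /=; congr Quad => /=; ring.
Qed.

Lemma qsphere_mobius k z :
  iter k (@qrot R) (qsphere (mobius_sphere (sector_gen k) z)) =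
  qsub1 (iter k (@qrot R) (qsphere z)).
Proof.
case: z => [w|].
  rewrite /= -[RHS]qpoint_mobius; congr iter.
  by rewrite /sector_gen; case: (k %% 4)%N => [|[|[|?]]].
rewrite [LHS]iter_rot_mod [in RHS]iter_rot_mod /sector_gen.
by have [] := mod4_cases k => -> /=; rewrite /qsub1 /qrot /=; congr Quad; ring.
Qed.

(** Two quarter turns make -1/z into 1/z, which exchanges |z|^2 and 1. The factor [s] is 1/|z|^2 at
    a finite nonzero point, and 1 at 0 and infinity. *)
Lemma qsphere_inversion z : exists2 s : R, 0 < s &
  iter 2 (@qrot R) (qsphere (mobius_sphere genS z)) =
  qscale s (qinv (qsphere z)).
Proof.
have inf : iter 2 (@qrot R) (Quad 1 0 0 0) = qscale 1 (qinv (qpoint 0)).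
  by rewrite /qscale /qrot /= expr0n /= !mul1r !oppr0 addr0.
case: z => [w|] /=; last first.
  by exists 1 => //; rewrite /qscale /qinv /qrot /= expr0n /= !mul1r !oppr0 addr0.
case: eqP => [->|/eqP w0]; first by exists 1.
exists ((complex.Re w ^+ 2 + complex.Im w ^+ 2)^-1).
  have := normc_gt0 w0; case: w {w0} => x y /=; rewrite sqrtr_gt0 => ?.
  by rewrite invr_gt0.
have := normc_gt0 w0; case: w {w0} => x y /=; rewrite sqrtr_gt0 => n0.
rewrite /qscale /qrot /=; congr Quad; rewrite ?mulVf ?gt_eqF//.
- by field; rewrite gt_eqF.
- by field; rewrite gt_eqF.
- by field; rewrite gt_eqF.
Qed.

End NaturalExtension.

(** * The domain: its invariance, and its avoidance of the diagonal *)

Definition fibre_check (G Z : region) : bool :=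
  all (fun k => all (fun c : cell =>
    let H := G ++ finite_pt ++ pull (iter k pull_rot) c.1 in
    if infeasible 4 H then true else if covered 4 H voids then true else
    all (fun r => covered 4 (sphere_pt ++ pull (iter k pull_rot) r)
      (fibre_voids ++ [:: Z])) c.2) cells) (iota 0 4).

(** If z = w, the conditions of the cell and of the fibre bear on one vector, so the concatenated
    systems must have no solution outside the voids. *)
Definition off_diagonal_check : bool :=
  all (fun c : cell => all (fun r =>
    covered 4 (finite_pt ++ c.1 ++ r) (voids ++ [::])) c.2) cells.

Lemma off_diagonal_checkT : off_diagonal_check.
Proof. by vm_compute. Qed.

Definition inverse_gen (h : generator) : generator :=
  match h with
  | genS => genS | genTV => genT | genUV => genU | genT => genTV | genU => genUV
  end.

Section Domain.
Variable R : realType.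
Implicit Types (w : Cplx R) (z : sphere R) (v : quad R) (p : sphere R * Cplx R).

Definition quad_domain v u := exists k (c : cell), [/\ c \in cells,
  inside c.1 (qseq (iter k (@qrot R) u)) & in_fibre c (iter k (@qrot R) v)].

Definition domain : set (sphere R * Cplx R) :=
  [set p | quad_domain (qsphere p.1) (qpoint p.2)].

Lemma inside_scale (s : R) H v : 0 < s ->
  inside H (qseq (qscale s v)) = inside H (qseq v).
Proof. by move=> s0; rewrite -(inside_zoom H (qseq v) s0). Qed.

Lemma in_fibre_scale (s : R) c v : 0 < s ->
  in_fibre c (qscale s v) = in_fibre c v.
Proof. by move=> s0; apply: eq_has => r; rewrite inside_scale. Qed.

Lemma iter_rot_scale k (s : R) v :
  iter k (@qrot R) (qscale s v) = qscale s (iter k (@qrot R) v).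
Proof. by elim: k => //= k ->; rewrite /qscale /qrot /= mulrN. Qed.

(** 1 / (-i z) = i / z, and i = (-i)^3. *)
Lemma qinv_rot k v :
  qinv (iter k (@qrot R) v) = iter (k * 3) (@qrot R) (qinv v).
Proof.
elim: k => // k IH; rewrite mulSn iterD -IH.
by rewrite /= /qinv /qrot /= ?opprK.
Qed.

Lemma qsub1K v : qadd1 (qsub1 v) = v.
Proof. by case: v => n x y d; rewrite /qadd1 /=; congr Quad; ring. Qed.

Lemma inverse_genK h w : mobius h (mobius (inverse_gen h) w) = w.
Proof.
case: h => /=; rewrite ?subrK ?addrK ?addrNK//.
by rewrite invrN invrK opprK.
Qed.

Lemma mobius_sphereK h z : mobius_sphere h (mobius_sphere (inverse_gen h) z) = z.
Proof.
case: h; case: z => [w|] //=; rewrite ?subrK ?addrK ?addrNK ?eqxx//.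
case: eqP => [->//|/eqP w0] /=.
by rewrite oppr_eq0 invr_eq0 (negbTE w0) invrN invrK opprK.
Qed.

Lemma qpoint_inversion w : w != 0 -> exists2 s : R, 0 < s &
  iter 2 (@qrot R) (qpoint (mobius genS w)) = qscale s (qinv (qpoint w)).
Proof.
by move=> w0; have [s s0 h] := qsphere_inversion (Some w);
  exists s => //; rewrite -h /= (negbTE w0).
Qed.

(** In the exponent, 3 k comes from [qinv_rot] and 2 from the sign in -1/z. The second conclusion
    locates the new second coordinate in a cell, which determines its branch. *)
Lemma quad_domain_inversion k c z w : c \in cells -> w != 0 ->
  inside c.1 (qseq (qinv (iter k (@qrot R) (qpoint w)))) ->
  in_fibre c (qinv (iter k (@qrot R) (qsphere z))) ->
  domain (mobius_sphere genS z, mobius genS w) /\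
  inside c.1 (qseq (iter (k * 3 + 2) (@qrot R) (qpoint (mobius genS w)))).
Proof.
move=> cC w0; rewrite !qinv_rot => wc zc.
have [s s0 sE] := qpoint_inversion w0; have [t t0 tE] := qsphere_inversion z.
have h : inside c.1 (qseq (iter (k * 3 + 2) (@qrot R) (qpoint (mobius genS w)))).
  by rewrite iterD sE iter_rot_scale inside_scale.
split=> //; exists (k * 3 + 2)%N, c; split=> //=.
by rewrite iterD tE iter_rot_scale in_fibre_scale.
Qed.

Lemma cellsP (c : cell) : c \in cells -> c \in inner_cells \/ c \in outer_cells.
Proof. by rewrite /cells mem_cat => /orP. Qed.

Lemma sector_gen_neqS k : sector_gen k <> genS.
Proof. by rewrite /sector_gen; case: (k %% 4)%N => [|[|[|?]]]. Qed.

Lemma branch0 : branch (0 : Cplx R) = genS.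
Proof. by rewrite /branch /Phi_diamond /= normr0 addr0 ler01. Qed.

Lemma cell_neq0 k (c : cell) w : c \in cells ->
  inside c.1 (qseq (iter k (@qrot R) (qpoint w))) -> w <> 0.
Proof.
move=> /cellsP[cI /(branch_inner cI)[]//|cO /(branch_outer cO) wk w0].
by move: wk; rewrite w0 branch0 => /esym/sector_gen_neqS.
Qed.

Lemma domain_neq0 p : domain p -> p.2 <> 0.
Proof. by move=> [k [c [cC /(cell_neq0 cC)]]]. Qed.

Lemma domain_off_diagonal : domain `<=` off_diagonal (R:=R).
Proof.
move=> [z w] [k [c [/= cC wc /hasP[r rc rz]]]]; rewrite /off_diagonal /= => zw.
have /allP/(_ _ cC)/allP/(_ _ rc) h := off_diagonal_checkT.
have w0 := null_iter_rot k (null_qpoint w).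
have [|T] := coveredVP (@voidsP R) h w0; last by [].
by rewrite !insideC finite_ptE// qd_iter_rot ltr01 wc; move: rz; rewrite zw.
Qed.

Lemma domainI : domain `&` F_domain (R:=R) = domain.
Proof.
apply/seteqP; split=> [p []//|p Dp]; split=> //; split.
  exact: domain_off_diagonal.
exact: domain_neq0.
Qed.

Lemma F_diamond_domain p : domain p -> domain (F_diamond p).
Proof.
case: p => z w [k [c [/= cC wc zc]]]; rewrite /F_diamond /f_diamond /=.
have [w0 z0] := (null_iter_rot k (null_qpoint w), null_iter_rot k (null_qsphere z)).
have w1 : 0 < qd (iter k (@qrot R) (qpoint w)) by rewrite qd_iter_rot ltr01.
have [cI|cO] := cellsP cC.
  have [-> /eqP wn0] := branch_inner cI wc.
  have [c' [c'C wc' zc']] := forward_inversion cI z0 w0 w1 wc zc.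
  by have [] := quad_domain_inversion c'C wn0 wc' zc'.
rewrite (branch_outer cO wc).
have [k' [c' [_ c'C wc' zc']]] := forward_translation cO z0 w0 w1 wc zc.
exists (k' + k)%N, c'; split=> //=; rewrite iterD.
  by rewrite qpoint_mobius.
by rewrite qsphere_mobius.
Qed.

Lemma domain_preimage p : domain p -> exists2 q, domain q & F_diamond q = p.
Proof.
case: p => z w Dp; have /eqP wn0 := domain_neq0 Dp.
case: Dp => k [c [/= cC wc zc]].
have [w0 z0] := (null_iter_rot k (null_qpoint w), null_iter_rot k (null_qsphere z)).
have w1 : 0 < qd (iter k (@qrot R) (qpoint w)) by rewrite qd_iter_rot ltr01.
have [k' [c' [c'C wc' zc']]] := backward_move cC z0 w0 w1 wc zc.
case: k' c'C wc' zc' => [k'|] /=.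
  move=> /andP[k'4 cO] wc' zc'.
  set h := sector_gen (k' + k).
  have wE : iter (k' + k) (@qrot R) (qpoint (mobius (inverse_gen h) w)) =
      qadd1 (iter k' (@qrot R) (iter k (@qrot R) (qpoint w))).
    by rewrite -iterD -[in RHS](inverse_genK h w) qpoint_mobius qsub1K.
  have zE : iter (k' + k) (@qrot R) (qsphere (mobius_sphere (inverse_gen h) z)) =
      qadd1 (iter k' (@qrot R) (iter k (@qrot R) (qsphere z))).
    by rewrite -iterD -[in RHS](mobius_sphereK h z) qsphere_mobius qsub1K.
  exists (mobius_sphere (inverse_gen h) z, mobius (inverse_gen h) w).
    exists (k' + k)%N, c'; split=> /=; last 2 first.
    - by rewrite wE.
    - by rewrite zE.
    by rewrite /cells mem_cat cO orbT.
  rewrite /F_diamond /f_diamond /= (branch_outer (k := (k' + k)%N) cO).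
    by rewrite mobius_sphereK inverse_genK.
  by rewrite wE.
move=> cI wc' zc'.
have c'C : c' \in cells by rewrite /cells mem_cat cI.
have [Dq wq] := quad_domain_inversion c'C wn0 wc' zc'.
exists (mobius_sphere genS z, mobius genS w) => //.
rewrite /F_diamond /f_diamond; have [-> _] := branch_inner cI wq.
by rewrite [mobius_sphere _ _](mobius_sphereK genS) [mobius _ _](inverse_genK genS).
Qed.

Lemma F_diamond_image : @F_diamond R @` (domain `&` F_domain (R:=R)) = domain.
Proof.
rewrite domainI; apply/seteqP; split=> [_ [p Dp <-]|p /domain_preimage[q Dq <-]].
  exact: F_diamond_domain.
by exists q.
Qed.

Lemma fibre_checkP G Z j z w : fibre_check G Z -> domain (z, w) ->
  inside G (qseq (iter j (@qrot R) (qpoint w))) ->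
  inside Z (qseq (iter j (@qrot R) (qsphere z))).
Proof.
move=> GZ [k [c [/= cC wc /hasP[r rc rz]]]] Gw.
(* The cell of [w] may be found after another rotation than [j]; [i] is k - j modulo 4, with -j
   written as 3 j to stay in [nat]. *)
pose i := ((k + j * 3) %% 4)%N.
have iE v : iter k (@qrot R) v = iter i (@qrot R) (iter j (@qrot R) v).
  rewrite -iter_rot_mod -iterD -addnA -mulnSr iterD; congr iter.
  by rewrite iter_rot_mod modnMl.
have i4 : i \in iota 0 4 by rewrite mem_iota ltn_mod.
rewrite iE in wc; rewrite iE in rz.
move: (iter j _ _) (null_iter_rot j (null_qpoint w)) (qd_iter_rot j (qpoint w))
  wc Gw => u u0 u1 wc Gw.
move: (iter j _ _) (null_iter_rot j (null_qsphere z)) rz => v v0 rz.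
have /allP/(_ _ i4)/allP/(_ _ cC) := GZ; cbv beta zeta.
have wH : inside (G ++ finite_pt ++ pull (iter i pull_rot) c.1) (qseq u).
  rewrite !insideC Gw finite_ptE// u1 ltr01 /=.
  by rewrite (inside_pull _ _ (adjoint_iter i (@adjoint_rot R))).
case: ifP => [/(infeasibleP (v := qseq u) erefl)|_]; first by rewrite wH.
case: ifP => [|_ /allP/(_ _ rc) h].
  by rewrite -[voids]cats0 => /(coveredVP (@voidsP R))/(_ u0 wH)[].
have [|T] := coveredVP (@fibre_voidsP R) h v0.
  by rewrite insideC sphere_ptT// (inside_pull _ _ (adjoint_iter i (@adjoint_rot R))).
by rewrite inE => /eqP->.
Qed.

End Domain.

(** * Injectivity in the interior of the domain *)

Section ComplexTopology.
Variable R : realType.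
Implicit Types (z w c : Cplx R) (t e : R).

Lemma normcR z : `|z| = (Normc.normc z)%:C.
Proof. by case: z => x y; rewrite normc_def. Qed.

(** Radii in [R[i]] are complex numbers; positivity forces their imaginary part to vanish, which
    leaves a real radius. *)
Lemma nbhs_discP z (A : set (Cplx R)) :
  nbhs z A <-> exists2 e, 0 < e & forall w, Normc.normc (w - z) < e -> A w.
Proof.
split=> [/nbhs_ballP[[e e'] /= + zA]|[e e0 zA]].
  rewrite ltcE /= => /andP[/eqP e'0 e0]; exists e => // w wz; apply: zA.
  by rewrite -ball_normE /= distrC normcR ltcE /= e'0 eqxx.
apply/nbhs_ballP; exists e%:C => [|w]; first by rewrite /= ltcR.
by rewrite -ball_normE /= distrC normcR ltcR => /zA.
Qed.

Lemma nbhs_ray z c (A : set (Cplx R)) : nbhs z A ->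
  exists2 e, 0 < e & forall t, 0 <= t < e -> A (z + t%:C * c).
Proof.
move=> /nbhs_discP[e e0 zA].
have c1 : 0 < Normc.normc c + 1 by rewrite ltr_wpDl// -ler0c -normcR normr_ge0.
exists (e / (Normc.normc c + 1)); first by rewrite divr_gt0.
move=> t /andP[t0 te]; apply: zA; rewrite addrAC subrr add0r.
rewrite ltr_pdivlMr// in te; apply: le_lt_trans te.
have -> : Normc.normc (t%:C * c) = t * Normc.normc c.
  have : `|t%:C * c| = (t * Normc.normc c)%:C.
    by rewrite normrM (normcR c) ger0_norm ?ler0c// rmorphM.
  by rewrite normcR => -[].
by rewrite mulrDr lerDl mulr1.
Qed.

Lemma Re_le_normc z : `|complex.Re z| <= Normc.normc z.
Proof.
by case: z => x y /=; rewrite -sqrtr_sqr ler_wsqrtr// lerDl sqr_ge0.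
Qed.

Lemma Im_le_normc z : `|complex.Im z| <= Normc.normc z.
Proof.
by case: z => x y /=; rewrite -sqrtr_sqr ler_wsqrtr// lerDr sqr_ge0.
Qed.

Lemma continuous_Re : continuous (@complex.Re R : Cplx R -> R).
Proof.
move=> z A /nbhs_ballP[e /= e0 zA].
apply: (proj2 (nbhs_discP z _)); exists e => // w wz; apply: zA.
by rewrite -ball_normE /= distrC -raddfB (le_lt_trans (Re_le_normc _)).
Qed.

Lemma continuous_Im : continuous (@complex.Im R : Cplx R -> R).
Proof.
move=> z A /nbhs_ballP[e /= e0 zA].
apply: (proj2 (nbhs_discP z _)); exists e => // w wz; apply: zA.
by rewrite -ball_normE /= distrC -raddfB (le_lt_trans (Im_le_normc _)).
Qed.

(** Outside a neighbourhood of infinity all points lie in a compact set, on which the scalar product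
    with [c] is bounded, whereas along the ray it grows like t |c|^2. *)
Lemma nbhs_infinity_ray (U : set (sphere R)) c : c != 0 -> nbhs (None : sphere R) U ->
  exists2 t, 1 < t & U (Some (t%:C * c)).
Proof.
move=> c0 [K [cK _] KU].
pose f (z : Cplx R) : R := complex.Re c * complex.Re z + complex.Im c * complex.Im z.
have cf : continuous f.
  move=> z; exact: cvgD (cvgM (cvg_cst _) (@continuous_Re z))
    (cvgM (cvg_cst _) (@continuous_Im z)).
have /compact_bounded[M [_ fM]] : compact (f @` K).
  by apply: continuous_compact => //; exact: continuous_subspaceT.
have n0 : 0 < complex.Re c ^+ 2 + complex.Im c ^+ 2.
  by have := normc_gt0 c0; case: c {c0 f cf fM} => x y /=; rewrite sqrtr_gt0.
pose t := (`|M| + 2) / (complex.Re c ^+ 2 + complex.Im c ^+ 2) + 1.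
exists (t + 1); first by rewrite ltrDr ltr_wpDl// divr_ge0// ltW.
apply: KU; left; exists ((t + 1)%:C * c) => // Kt.
have /fM : M < `|M| + 1 by rewrite ltr_pwDr// ler_norm.
move=> /(_ _ (ex_intro2 _ _ _ Kt erefl)); apply/negP; rewrite -ltNge.
have -> : f ((t + 1)%:C * c) = (t + 1) * (complex.Re c ^+ 2 + complex.Im c ^+ 2).
  by rewrite /f; move: (t + 1) => u; clear; case: c => x y /=; ring.
rewrite (lt_le_trans _ (ler_norm _))//.
rewrite -ltr_pdivrMr// /t -addrA ltr_wpDr// ?ltr_pM2r ?invr_gt0//; lra.
Qed.

End ComplexTopology.

(** * Strict fibre inequalities in the interior *)

Definition outer_sector1 := [:: ge 0 1 1 0; gt 0 1 (-1) 0; gt 0 1 1 (-1)].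
Definition outer_sector2 := [:: ge 0 1 1 0; gt 0 1 (-1) 0; gt 0 1 (-1) (-1)].
Definition open_diamond :=
  [:: gt 0 1 1 1; gt 0 1 (-1) 1; gt 0 (-1) 1 1; gt 0 (-1) (-1) 1].

(** Translation by -1 turns Re z <= 1/2 and |z - 1| >= 1 into Re z <= -1/2 and |z| >= 1, and leaves
    |Im z| <= 1/2 over the core unchanged; inversion turns |z| >= 1 into |z| <= 1. These bounds,
    strict in the interior, let the image reveal the branch. *)
Definition interior_check : bool :=
  [&& fibre_check outer_sector1 [:: re_le; out1],
      fibre_check outer_sector2 [:: re_le; out1],
      fibre_check core.1 [:: im_le; im_ge] &
      fibre_check open_diamond [:: out0]].

Lemma interior_checkT : interior_check.
Proof. by vm_compute. Qed.

Section Injectivity.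
Variable R : realType.
Implicit Types (z w a b : Cplx R) (v : quad R) (p q : sphere R * Cplx R) (t e : R).

Definition direction (k : nat) : Cplx R :=
  match (k %% 4)%N with
  | 0 => 1 +i* 0 | 1 => 0 +i* 1 | 2 => (-1) +i* 0 | _ => 0 +i* (-1)
  end.

Lemma direction_neq0 k : direction k != 0.
Proof.
rewrite /direction eq_complex; case: (k %% 4)%N => [|[|[|?]]] /=;
  by rewrite ?oppr_eq0 ?oner_eq0 ?andbF.
Qed.

Lemma qpoint_shift k z t : let v := iter k (@qrot R) (qpoint z) in
  iter k (@qrot R) (qpoint (z + t%:C * direction k)) =
  Quad (qn v + 2 * t * qx v + t ^+ 2) (qx v + t) (qy v) 1.
Proof.
case: z => x y /=; rewrite iter_rot_mod [iter k _ _]iter_rot_mod /direction.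
by have [] := mod4_cases k => -> /=; rewrite /qrot /=; congr Quad => /=; ring.
Qed.

Lemma qpoint_shift_left k z t : let v := iter k (@qrot R) (qpoint z) in
  iter k (@qrot R) (qpoint (z + t%:C * direction k.+1)) =
  Quad (qn v + 2 * t * qy v + t ^+ 2) (qx v) (qy v + t) 1.
Proof.
have -> : direction k.+1 = direction (k %% 4).+1.
  by rewrite /direction -[in LHS]addn1 -modnDml addn1.
case: z => x y /=; rewrite iter_rot_mod [iter k _ _]iter_rot_mod.
by have [] := mod4_cases k => -> /=; rewrite /qrot /direction /=; congr Quad => /=; ring.
Qed.

Lemma qpoint_shift_right k z t : let v := iter k (@qrot R) (qpoint z) in
  iter k (@qrot R) (qpoint (z + t%:C * direction k.+3)) =
  Quad (qn v - 2 * t * qy v + t ^+ 2) (qx v) (qy v - t) 1.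
Proof.
have -> : direction k.+3 = direction (k %% 4).+3.
  by rewrite /direction -[in LHS]addn3 -modnDml addn3.
case: z => x y /=; rewrite iter_rot_mod [iter k _ _]iter_rot_mod.
by have [] := mod4_cases k => -> /=; rewrite /qrot /direction /=; congr Quad => /=; ring.
Qed.

Lemma interior_ray z w a b : (domain (R := R))° (Some z, w) ->
  exists2 e, 0 < e & forall t, 0 <= t < e ->
    domain (Some (z + t%:C * a), w + t%:C * b).
Proof.
move=> [[U V] /= [zU wV] UV].
have [e1 e10 h1] := @nbhs_ray _ z a [set z | U (Some z)] zU.
have [e2 e20 h2] := nbhs_ray b wV.
exists (Num.min e1 e2) => [|t /andP[t0]]; first by rewrite lt_min e10.
by rewrite lt_min => /andP[t1 t2]; apply: UV; split=> /=;
  [apply: h1 | apply: h2]; rewrite t0.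
Qed.

Lemma interior_infinity w k : (domain (R := R))° (None, w) ->
  exists2 t, 1 < t & domain (Some (t%:C * direction k), w).
Proof.
move=> [[U V] /= [zU wV] UV].
have [t t1 tU] := nbhs_infinity_ray (direction_neq0 k) zU.
by exists t => //; apply: UV; split=> //=; exact: nbhs_singleton wV.
Qed.

Lemma in_outer_sector k (c : cell) w : c \in outer_cells ->
  let u := iter k (@qrot R) (qpoint w) in inside c.1 (qseq u) ->
  inside outer_sector1 (qseq u) \/ inside outer_sector2 (qseq u).
Proof.
move=> cO u wc; have /allP/(_ _ cO) h := out_diamond_checkT.
have [|T] := coveredVP (@voidsP R) h (null_iter_rot k (null_qpoint w)).
  by rewrite insideC finite_ptE ?qd_iter_rot ?ltr01//; apply: null_iter_rot; exact: null_qpoint.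
by rewrite !inE => /orP[] /eqP->; [left | right].
Qed.

Lemma outer_fibre k (c : cell) (z : sphere R) w : c \in outer_cells ->
  inside c.1 (qseq (iter k (@qrot R) (qpoint w))) -> domain (z, w) ->
  let v := iter k (@qrot R) (qsphere z) in
  2 * qx v <= qd v /\ 2 * qx v <= qn v.
Proof.
move=> cO wc Dzw v; have [c1 c2 _ _] := and4P interior_checkT.
have : inside [:: re_le; out1] (qseq v).
  by case: (in_outer_sector cO wc) => h; [exact: fibre_checkP c1 Dzw h |
    exact: fibre_checkP c2 Dzw h].
by conditions; split; lra.
Qed.

Lemma qn_iter_rot k v : qn (iter k (@qrot R) v) = qn v.
Proof. by elim: k. Qed.

Lemma small_time e : 0 < e -> exists t, [/\ 0 < t, t < e & t <= 1 / 2].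
Proof.
move=> e0; have [e1|e1] := lerP e (1 / 2); first by exists (e / 2); split; lra.
by exists (1 / 2); split; lra.
Qed.

(** Infinity cannot occur: near it there are points with large rotated real part, against Re z <=
    1/2. For finite [z] a small move along i^k stays in the domain, and the weak inequalities at the
    moved point give strict ones at [z]. *)
Lemma interior_outer k (c : cell) p : (domain (R := R))° p -> c \in outer_cells ->
  inside c.1 (qseq (iter k (@qrot R) (qpoint p.2))) ->
  exists2 z, p.1 = Some z & let v := iter k (@qrot R) (qpoint z) in
    2 * qx v < 1 /\ 2 * qx v < qn v.
Proof.
case: p => [[z|] w] /= Dp cO wc; last first.
  have [t t1 Dt] := interior_infinity k Dp.
  have /= := outer_fibre cO wc Dt.
  have /= := qpoint_shift k 0 t; rewrite add0r => ->.
  have -> : qx (iter k (@qrot R) (qpoint 0)) = 0.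
    by rewrite iter_rot_mod; have [] := mod4_cases k => -> /=; rewrite ?oppr0.
  by move=> /= []; lra.
exists z => //; have [e e0 De] := interior_ray (direction k) 0 Dp.
set v := iter _ _ _.
have [t [t0 te t1]] := small_time e0.
have := De t; rewrite mulr0 addr0 ltW// te => /(_ isT) Dt.
have := outer_fibre cO wc Dt.
have /= -> := qpoint_shift k z t; rewrite -/v /= => -[h1 h2].
split; first by lra.
have h3 : 0 < t * (2 - 2 * qx v - t) by apply: mulr_gt0; lra.
by lra.
Qed.

(** The hypothesis describes the closed core while the fibre bound holds over the open one. So [w]
    is pushed inwards along i^k while [z] is pushed sideways, and the weak bound after the move
    gives the strict one before it. *)
Lemma interior_core k z w : (domain (R := R))° (Some z, w) ->
  let u := iter k (@qrot R) (qpoint w) in `|qy u| <= qx u - 1 ->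
  let v := iter k (@qrot R) (qpoint z) in
  -1 < 2 * qy v /\ 2 * qy v < 1.
Proof.
move=> Dp u; rewrite ler_norml => /andP[u1 u2] v.
have [_ _ c3 _] := and4P interior_checkT.
have core_shift t : 0 < t ->
    inside core.1 (qseq (iter k (@qrot R) (qpoint (w + t%:C * direction k)))).
  move=> t0; have /= -> := qpoint_shift k w t; rewrite -/u.
  by rewrite /inside /holds /= ?zvals andbT; apply/andP; split; lra.
split.
  have [e e0 De] := interior_ray (direction k.+3) (direction k) Dp.
  have t0 : 0 < e / 2 by rewrite divr_gt0.
  have te : 0 <= e / 2 < e by apply/andP; split; lra.
  have := fibre_checkP c3 (De _ te) (core_shift _ t0).
  have /= -> := qpoint_shift_right k z (e / 2); rewrite -/v.
  by conditions; lra.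
have [e e0 De] := interior_ray (direction k.+1) (direction k) Dp.
have t0 : 0 < e / 2 by rewrite divr_gt0.
have te : 0 <= e / 2 < e by apply/andP; split; lra.
have := fibre_checkP c3 (De _ te) (core_shift _ t0).
have /= -> := qpoint_shift_left k z (e / 2); rewrite -/v.
by conditions; lra.
Qed.

Lemma shrink_lt1 t (s : R) : 0 < t -> t <= 1 / 2 -> s <= 1 -> (1 - t) * s < 1.
Proof.
move=> t0 t1 s1.
have : 0 <= (1 - t) * (1 - s) by apply: mulr_ge0; lra.
by lra.
Qed.

Lemma qpoint_shrink z t : qpoint (z + t%:C * - z) =
  Quad ((1 - t) ^+ 2 * qn (qpoint z)) ((1 - t) * qx (qpoint z))
       ((1 - t) * qy (qpoint z)) 1.
Proof. by case: z => x y; rewrite /qpoint /=; congr Quad; ring. Qed.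

Lemma open_diamond_shrink w t : Phi_diamond w -> 0 < t -> t <= 1 / 2 ->
  inside open_diamond (qseq (qpoint (w + t%:C * - w))).
Proof.
rewrite qpoint_shrink /Phi_diamond /= => wP t0 t1.
have xP := ler_norm (complex.Re w); have yP := ler_norm (complex.Im w).
have xN := ler_norm (- complex.Re w); have yN := ler_norm (- complex.Im w).
rewrite normrN in xN; rewrite normrN in yN.
have h1 := @shrink_lt1 t (complex.Re w + complex.Im w) t0 t1.
have h2 := @shrink_lt1 t (complex.Re w - complex.Im w) t0 t1.
have h3 := @shrink_lt1 t (- complex.Re w + complex.Im w) t0 t1.
have h4 := @shrink_lt1 t (- complex.Re w - complex.Im w) t0 t1.
rewrite /inside /holds /= ?zvals andbT; apply/and4P.
have {}h1 := h1 ltac:(lra); have {}h2 := h2 ltac:(lra).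
have {}h3 := h3 ltac:(lra); have {}h4 := h4 ltac:(lra).
by clear wP xP yP xN yN; split; lra.
Qed.

(** Shrinking z and w together towards 0 brings w into the open diamond, where the modulus in the
    fibre is still at least 1; before shrinking it was larger. *)
Lemma interior_inner z w : (domain (R := R))° (Some z, w) -> Phi_diamond w ->
  1 < qn (qpoint z).
Proof.
move=> Dp wP; have [_ _ _ c4] := and4P interior_checkT.
have [e e0 De] := interior_ray (- z) (- w) Dp.
have [t [t0 te t1]] := small_time e0.
have Dt : domain (Some (z + t%:C * - z), w + t%:C * - w) by apply: De; rewrite ltW.
have : inside [:: out0] (qseq (qpoint (z + t%:C * - z))).
  exact: (fibre_checkP (j := 0) c4 Dt (open_diamond_shrink wP t0 t1)).
rewrite qpoint_shrink; move: (qn _) (qx _) (qy _) => n x y.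
clear c4 wP De Dt; conditions.
rewrite ltNge; apply/negP => n1.
have h : (1 - t) ^+ 2 * n <= (1 - t) ^+ 2 * 1.
  by apply: ler_wpM2l => //; exact: sqr_ge0.
have : 0 < t * (2 - t) by apply: mulr_gt0; lra.
by lra.
Qed.

(* What is known of the image of an interior point whose second coordinate is
   translated as in sector [k]. *)
Definition translated_to k p := exists2 z, p.1 = Some z &
  let v := iter k (@qrot R) (qpoint z) in
  let u := iter k (@qrot R) (qpoint p.2) in
  [/\ 2 * qx v < - 1, 1 < qn v, 0 < qx u + `|qy u| &
      `|qy u| <= qx u -> -1 < 2 * qy v /\ 2 * qy v < 1].

Lemma translated_to_mod k p : translated_to (k %% 4) p -> translated_to k p.
Proof. by move=> [z zE]; rewrite -!iter_rot_mod; exists z. Qed.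

Lemma interior_translated p : (domain (R := R))° p -> branch p.2 <> genS ->
  exists k, branch p.2 = sector_gen k /\ translated_to k (F_diamond p).
Proof.
move=> Dp; have [k [c [/= cC wc zc]]] := interior_subset Dp.
have [cI|cO] := cellsP cC.
  by have [-> _] := branch_inner cI wc.
move=> _; have bw := branch_outer cO wc; exists k; split=> //.
have [z zE [h1 h2]] := interior_outer Dp cO wc.
exists (mobius (sector_gen k) z).
  rewrite /F_diamond /= bw zE /sector_gen.
  by case: (k %% 4)%N => [|[|[|?]]].
rewrite /F_diamond /f_diamond /= bw !qpoint_mobius /=.
have core_fibre : `|qy (iter k (@qrot R) (qpoint p.2))| <=
    qx (iter k (@qrot R) (qpoint p.2)) - 1 ->
    -1 < 2 * qy (iter k (@qrot R) (qpoint z)) /\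
    2 * qy (iter k (@qrot R) (qpoint z)) < 1.
  apply: (interior_core (w := p.2)).
  by case: p Dp zE {wc zc bw h1 h2 cO cC c} => z0 w /= + zE; rewrite zE.
have us := in_outer_sector cO wc; clear wc zc bw cO cC c Dp zE.
rewrite !qd_iter_rot /=; move: h1 h2 core_fibre us (qd_iter_rot k (qpoint p.2)).
move: (iter k _ (qpoint z)) (iter k _ (qpoint p.2)) => [vn vx vy vd] [un ux uy ud] /=.
move=> h1 h2 core_fibre us d1.
have [y1 y2] := (ler_norm uy, ler_norm (- uy)); rewrite normrN in y2.
split=> //; [lra | lra |].
by case: us; conditions; lra.
Qed.

Lemma interior_inverted p : (domain (R := R))° p -> branch p.2 = genS ->
  forall z, (F_diamond p).1 = Some z -> qn (qpoint z) < 1.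
Proof.
move=> Dp; have := interior_subset Dp => /domain_neq0/eqP.
case: p Dp => [[z|] w] Dp w0 /= bw z'; rewrite bw /=; last first.
  by move=> [<-] /=; rewrite expr0n addr0 ltr01.
have wP : Phi_diamond w.
  move: bw; rewrite /branch; case: ifP => // _.
  by do 3!case: ifP => // _.
have n1 := interior_inner Dp wP.
have [s s0] := qsphere_inversion (Some z).
rewrite [mobius_sphere _ _]/=; case: eqP => // z0 sE [<-].
have s1 : s * qn (qpoint z) = 1 by have := congr1 (@qd R) sE.
have sN : qn (qpoint (- z^-1)) = s.
  by have := congr1 (@qn R) sE; rewrite [qn (qscale _ _)]/= mulr1 => <-.
suff: qn (qpoint (- z^-1)) < 1 by [].
have : s * 1 < s * qn (qpoint z) by rewrite ltr_pM2l.
by lra.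
Qed.

(** With v and u the rotated coordinates, two adjacent sectors give Re v < -1/2 and Im v < -1/2. If
    |Im u| <= Re u or |Re u| <= Im u, the fibre bound excludes one of these; otherwise Re u + |Im u|
    > 0 and Im u + |Re u| > 0 conflict. *)
Lemma translated_next k p : translated_to k p -> ~ translated_to k.+1 p.
Proof.
move=> [z zE /=]; set v := iter k _ (qpoint z); set u := iter k _ (qpoint p.2).
move=> [h1 _ h2 h3] [z']; rewrite zE => -[<-]; rewrite /= -/v -/u normrN.
move=> [h4 _ h5 h6].
have [yx|yx] := lerP (`|qy u|) (qx u); first by have [] := h3 yx; lra.
have [xy|xy] := lerP (`|qx u|) (qy u); first by have [] := h6 xy; lra.
case: (lerP 0 (qx u)) (lerP 0 (qy u)) h2 h5 xy yx => x0 [] y0;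
  rewrite ?(ger0_norm x0) ?(ltr0_norm x0) ?(ger0_norm y0) ?(ltr0_norm y0); lra.
Qed.

Lemma translated_opposite k p : translated_to k p -> ~ translated_to k.+2 p.
Proof.
move=> [z zE [h1 _ _ _]] [z']; rewrite {}zE => -[<-] /= [h2 _ _ _].
by lra.
Qed.

Lemma translated_unique j k p : translated_to j p -> translated_to k p ->
  sector_gen j = sector_gen k.
Proof.
wlog: j k / (j %% 4 <= k %% 4)%N.
  move=> h hj hk; have [/h|/ltnW/h] := leqP (j %% 4) (k %% 4); first exact.
  by move=> ->.
have h i : translated_to i p -> translated_to (i %% 4) p.
  by move=> [z zE hz]; exists z => //; rewrite -!iter_rot_mod.
move=> jk /h hj /h hk; rewrite /sector_gen.
(* Residues 0 and 3 are adjacent through 4, so [j] is also represented by its residue plus 4. *)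
have hj' : translated_to (j %% 4 + 4) p.
  by apply: translated_to_mod; rewrite modnDr modn_mod.
move: jk hj hk hj'; have [] := mod4_cases j => ->; have [] := mod4_cases k => -> //= _.
- by move=> /translated_next.
- by move=> /translated_opposite.
- by move=> _ /translated_next.
- by move=> /translated_next.
- by move=> /translated_opposite.
- by move=> /translated_next.
Qed.

Lemma mobius_inj h : injective (@mobius R h).
Proof.
apply: (can_inj (g := mobius (inverse_gen h))) => w.
by have := inverse_genK (inverse_gen h) w; case: h.
Qed.

Lemma mobius_sphere_inj h : injective (@mobius_sphere R h).
Proof.
apply: (can_inj (g := mobius_sphere (inverse_gen h))) => z.
by have := mobius_sphereK (inverse_gen h) z; case: h.
Qed.

(** The image of an interior point has |z| > 1 after a translation, and cannot be a finite z with
    |z| >= 1 after the inversion. Only two translations remain to be compared, by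
    [translated_unique]. *)
Lemma F_diamond_interior_inj p q : (domain (R := R))° p ->
  (domain (R := R))° q -> F_diamond p = F_diamond q -> p = q.
Proof.
move=> Dp Dq pq.
suff b : branch p.2 = branch q.2.
  case: p q pq b {Dp Dq} => [z w] [z' w'] [/=].
  rewrite /f_diamond => h1 h2 b; rewrite b in h1 h2.
  by rewrite (mobius_sphere_inj h1) (mobius_inj h2).
have [pS|pS] := pselect (branch p.2 = genS); have [qS|qS] := pselect (branch q.2 = genS).
- by rewrite pS qS.
- have [k [_ [z zE [_ n1 _ _]]]] := interior_translated Dq qS.
  have := interior_inverted Dp pS (z := z); rewrite pq => /(_ zE).
  by rewrite -(qn_iter_rot k) ltNge ltW.
- have [k [_ [z zE [_ n1 _ _]]]] := interior_translated Dp pS.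
  have := interior_inverted Dq qS (z := z); rewrite -pq => /(_ zE).
  by rewrite -(qn_iter_rot k) ltNge ltW.
- have [j [-> hj]] := interior_translated Dp pS.
  have [k [-> hk]] := interior_translated Dq qS.
  by rewrite pq in hj; exact: translated_unique hj hk.
Qed.

Lemma domain_bijectivity : bijectivity_domain (domain (R := R)).
Proof.
split; first exact: F_diamond_image.
rewrite domainI.
(* The default [point] is never reached on the domain, by [domain_preimage]. *)
pose g p : sphere R * Cplx R :=
  if pselect (exists q, (domain (R := R))° q /\ F_diamond q = p) is left h
  then projT1 (cid h)
  else if pselect (exists q, domain q /\ F_diamond q = p) is left h
  then projT1 (cid h) else point.
have gP p : domain p -> domain (g p) /\ F_diamond (g p) = p.
  move=> Dp; rewrite /g; case: pselect => [h|_].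
    by case: (projT2 (cid h)) => /interior_subset.
  case: pselect => [h|[]]; first exact: projT2 (cid h).
  by have [q Dq qp] := domain_preimage Dp; exists q.
have gI p : (domain (R := R))° p -> g (F_diamond p) = p.
  move=> Dp; rewrite /g; case: pselect => [h|[]]; last by exists p.
  by case: (projT2 (cid h)) => Dq; exact: F_diamond_interior_inj.
exists [set p | domain p /\ g (F_diamond p) <> p].
  move=> p [Dp gp]; split; first exact: subset_closure.
  by move=> /gI.
split.
- by move=> p [Dp _]; exact: F_diamond_domain.
- move=> p q; rewrite !inE => -[Dp hp] [Dq hq] pq.
  have <- : g (F_diamond p) = p by apply: contrapT => h; exact: hp.
  by rewrite pq; apply: contrapT => h; exact: hq.
- move=> p Dp; have [Dg gE] := gP p Dp; exists (g p) => //; split=> //.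
  by move=> [_]; rewrite gE.
Qed.

End Injectivity.

(** * Boundaries of regions *)

Section Tame.
Variables (T : Type) (P : set T -> Prop).
Implicit Types A B : set T.

(** The shape of [bounded_by_lines_and_arcs] with the kind of curve abstracted; [region_boundary]
    relies on the two being convertible. *)
Definition tame A := exists (n : nat) (L : 'I_n -> set T),
  (forall j, P (L j)) /\ A = \bigcup_j L j.

Lemma tame0 : tame set0.
Proof.
exists 0%N, (fun=> set0); split; first by case.
by apply/seteqP; split=> // x [[]].
Qed.

Lemma tame1 A : P A -> tame A.
Proof.
move=> PA; exists 1%N, (fun=> A); split=> //.
by apply/seteqP; split=> [x Ax|x [? _]//]; exists ord0.
Qed.

Lemma tameU A B : tame A -> tame B -> tame (A `|` B).
Proof.
move=> [m [L [PL ->]]] [n [M [PM ->]]].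
exists (m + n)%N, (fun j => match fintype.split j with inl i => L i | inr i => M i end).
split=> [j|]; first by case: fintype.split.
apply/seteqP; split=> [x [[i _ Lx]|[i _ Mx]]|x [j _]].
- by exists (lshift n i) => //; rewrite (unsplitK (inl i)).
- by exists (rshift m i) => //; rewrite (unsplitK (inr i)).
- by case: fintype.split => i ?; [left | right]; exists i.
Qed.

Lemma tame_seq (I : eqType) (s : seq I) (Q : I -> Prop) (F : I -> set T) :
  (forall i, i \in s -> Q i -> tame (F i)) ->
  tame (\bigcup_(i in [set i | i \in s /\ Q i]) F i).
Proof.
elim: s => [|i s IH] tF.
  by rewrite (_ : [set _ | _] = set0) ?bigcup_set0//; [exact: tame0 | apply/seteqP; split=> i []].
have tE : \bigcup_(j in [set j | j \in i :: s /\ Q j]) F j =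
    (if pselect (Q i) then F i else set0) `|`
    \bigcup_(j in [set j | j \in s /\ Q j]) F j.
  apply/seteqP; split=> x.
    move=> [j [+ Qj] Fx]; rewrite inE => /orP[/eqP ji|js].
      by left; case: pselect => //; rewrite -ji.
    by right; exists j.
  case=> [+|[j [js Qj] Fx]]; last by exists j => //; rewrite /= inE js orbT.
  by case: (pselect (Q i)) => [Qi Fx|_ []]; exists i => //; rewrite /= inE eqxx.
rewrite tE; apply: tameU.
  case: (pselect (Q i)) => [Qi|nQ] /=; last exact: tame0.
  by apply: tF; rewrite ?inE ?eqxx.
by apply: IH => j js; apply: tF; rewrite inE js orbT.
Qed.

End Tame.

(** * Closed sets of reals that change at finitely many points *)

Section Gaps.
Variable R : realType.
Implicit Types (S : set R) (T : seq R) (x y t : R).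

Definition constant_off S T := forall x y,
  (forall t, t \in T -> ~ (Num.min x y <= t <= Num.max x y)) -> S x -> S y.

Lemma max_below T x : (exists2 t, t \in T & t < x) ->
  exists2 a, a \in T & a < x /\ forall t, t \in T -> t < x -> t <= a.
Proof.
elim: T => [[t]//|u T IH] [t + tx].
have [[s sT sx]|noT] := pselect (exists2 t, t \in T & t < x).
  have [a aT [ax aM]] : exists2 a, a \in T & a < x /\
    forall t, t \in T -> t < x -> t <= a by apply: IH; exists s.
  have [ux|xu] := ltrP u x; last first.
    exists a; first by rewrite inE aT orbT.
    split=> // v; rewrite inE => /orP[/eqP->|/aM//]; rewrite ltNge xu//.
  have [ua|au] := lerP u a.
    by exists a; rewrite ?inE ?aT ?orbT//; split=> // v; rewrite inE => /orP[/eqP->|/aM].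
  exists u; rewrite ?inE ?eqxx//; split=> // v; rewrite inE => /orP[/eqP->//|/aM h vx].
  by rewrite (le_trans (h vx))// ltW.
rewrite inE => /orP[/eqP tu|tT]; last by case: noT; exists t.
exists u; rewrite ?inE ?eqxx// -tu; split=> // v; rewrite inE => /orP[/eqP->|vT vx].
  by rewrite tu.
by case: noT; exists v.
Qed.

Lemma min_above T x : (exists2 t, t \in T & x < t) ->
  exists2 b, b \in T & x < b /\ forall t, t \in T -> x < t -> b <= t.
Proof.
move=> [t tT xt].
have [|a /mapP[b bT ->]] := @max_below [seq - t | t <- T] (- x).
  by exists (- t); rewrite ?ltrN2//; apply/mapP; exists t.
rewrite ltrN2 => -[xb h]; exists b => //; split=> // s sT xs.
by rewrite -lerN2 h ?ltrN2//; apply/mapP; exists s.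
Qed.

Lemma closed_gap S x y : closed S -> x < y -> (forall t, x < t < y -> S t) ->
  forall t, x <= t <= y -> S t.
Proof.
move=> cS xy h t /andP[xt ty]; apply: cS.
have [tx|ntx] := eqVneq t x; last first.
  have [tty|nty] := eqVneq t y; last first.
    by apply: subset_closure; apply: h; rewrite !lt_neqAle xt ty eq_sym ntx nty.
  rewrite tty => A /nbhs_ballP[e /= e0 yA].
  pose s := Num.max ((x + y) / 2) (y - e / 2).
  have s1 : s < y by rewrite gt_max; apply/andP; split; lra.
  have s2 : x < s by rewrite lt_max; apply/orP; left; lra.
  have s3 : y - e / 2 <= s by rewrite le_max lexx orbT.
  exists s; split; first by apply: h; rewrite s2.
  by apply: yA; rewrite -ball_normE /= gtr0_norm ?subr_gt0//; lra.
rewrite tx => A /nbhs_ballP[e /= e0 xA].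
pose s := Num.min ((x + y) / 2) (x + e / 2).
have s1 : x < s by rewrite lt_min; apply/andP; split; lra.
have s2 : s < y by rewrite gt_min; apply/orP; left; lra.
have s3 : s <= x + e / 2 by rewrite ge_min lexx orbT.
exists s; split; first by apply: h; rewrite s1.
by apply: xA; rewrite -ball_normE /= ltr0_norm ?subr_lt0// opprB; lra.
Qed.

(** Between consecutive points of [T] membership in [S] is constant, and closedness adds the ends of
    the gap. The last three cases arise where [T] has no point on one side of [x], or on either. *)
Lemma gap_decomposition S T x : closed S -> constant_off S T -> S x ->
  [\/ exists a b, [/\ a \in T, b \in T, a <= x <= b &
                     forall t, a <= t <= b -> S t],
      exists a, [/\ a \in T, a <= x & forall t, a <= t -> S t],
      exists b, [/\ b \in T, x <= b & forall t, t <= b -> S t] |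
      forall t, S t].
Proof.
move=> cS cT Sx; have [xT|xT] := boolP (x \in T).
  by apply: Or41; exists x, x; rewrite lexx; split=> // t; rewrite -eq_le => /eqP<-.
have noT y : (forall t, t \in T -> t < x -> t < y) ->
    (forall t, t \in T -> x < t -> y < t) -> S y.
  move=> h1 h2; apply: cT Sx => t tT; rewrite ge_min le_max => /andP[h3 h4].
  have [tx|xt|tx] := ltgtP t x; last by rewrite -tx tT in xT.
    by have := h1 _ tT tx; move: h3 h4; rewrite !leNgt tx; lra.
  by have := h2 _ tT xt; lra.
have [lT|lT] := pselect (exists2 t, t \in T & t < x);
  have [uT|uT] := pselect (exists2 t, t \in T & x < t).
- have [a aT [ax aM]] := max_below lT; have [b bT [xb bm]] := min_above uT.
  apply: Or41; exists a, b; split=> //; first by rewrite !ltW.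
  apply: closed_gap => //; first exact: lt_trans xb.
  move=> t /andP[at_ tb]; apply: noT => u vT ux.
    exact: le_lt_trans (aM _ vT ux) at_.
  exact: lt_le_trans tb (bm _ vT ux).
- have [a aT [ax aM]] := max_below lT.
  apply: Or42; exists a; split=> //; first exact: ltW.
  move=> t at_; apply: (closed_gap (x := a) (y := t + 1)) => //; first lra.
    move=> s /andP[as_ _]; apply: noT => u vT ux.
      exact: le_lt_trans (aM _ vT ux) as_.
    by case: uT; exists u.
  by rewrite at_ lerDl ler01.
- have [b bT [xb bm]] := min_above uT.
  apply: Or43; exists b; split=> //; first exact: ltW.
  move=> t tb; apply: (closed_gap (x := t - 1) (y := b)) => //; first lra.
    move=> s /andP[_ sb]; apply: noT => u vT ux.
      by case: lT; exists u.
    exact: lt_le_trans sb (bm _ vT ux).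
  by rewrite tb gerBl ler01.
- apply: Or44 => t; apply: noT => u vT ux; first by case: lT; exists u.
  by case: uT; exists u.
Qed.

End Gaps.

(** * Boundary points along a curve *)

Section Boundary.
Variable R : realType.
Implicit Types (f g : seq Z) (H : region) (w p q : Cplx R) (t x y : R).

Definition value f w : R := lform f (qseq (qpoint w)).

Definition points H : set (Cplx R) := [set w | inside H (qseq (qpoint w))].

(** The discriminant b^2 + c^2 - 4 a d is positive exactly for genuine lines and for circles of
    positive radius. *)
Definition proper_curve f : bool :=
  let n := nth Z0 f in
  Z.ltb 0 (Z.add (Z.add (Z.mul (n 1%N) (n 1%N)) (Z.mul (n 2%N) (n 2%N)))
                 (Z.opp (Z.mul 4 (Z.mul (n 0%N) (n 3%N))))).

Notation coef f i := (zval R (nth Z0 f i)).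

Lemma proper_curveP f : proper_curve f ->
  4 * (coef f 0 * coef f 3) < coef f 1 ^+ 2 + coef f 2 ^+ 2.
Proof.
move=> /(@zval_gt0 R); rewrite !zvalD zvalN !zvalM.
have -> : zval R 4 = 4 by [].
by rewrite !expr2 subr_gt0.
Qed.

Lemma valueE f x y : value f (x +i* y) =
  coef f 0 * (x ^+ 2 + y ^+ 2) + coef f 1 * x + coef f 2 * y + coef f 3.
Proof. by rewrite /value /qseq lform_quad /= mulr1. Qed.

Lemma continuous_value f : continuous (value f).
Proof.
have -> : value f = fun w => coef f 0 * (complex.Re w * complex.Re w +
    complex.Im w * complex.Im w) + coef f 1 * complex.Re w +
    coef f 2 * complex.Im w + coef f 3.
  by apply/funext => -[x y]; rewrite valueE /= !expr2.
move=> w; have rw := @continuous_Re R w; have iw := @continuous_Im R w.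
exact: cvgD (cvgD (cvgD (cvgM (cvg_cst _) (cvgD (cvgM rw rw) (cvgM iw iw)))
  (cvgM (cvg_cst _) rw)) (cvgM (cvg_cst _) iw)) (cvg_cst _).
Qed.

Lemma continuous_pair (T : topologicalType) (u v : T -> R) (s : T) :
  {for s, continuous u} -> {for s, continuous v} ->
  {for s, continuous (fun s => (u s +i* v s) : Cplx R)}.
Proof.
move=> cu cv A /nbhs_discP[e e0 sA].
have e2 : 0 < e / 2 by rewrite divr_gt0.
have /cvgrPdist_lt/(_ _ e2) us := cu; have /cvgrPdist_lt/(_ _ e2) vs := cv.
suff : nbhs s [set t | A (u t +i* v t)] by [].
apply: filterS2 us vs => t us vs; apply: sA => /=.
rewrite distrC in us; rewrite distrC in vs.
have h : (u t - u s) ^+ 2 + (v t - v s) ^+ 2 <= (`|u t - u s| + `|v t - v s|) ^+ 2.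
  rewrite [leRHS]sqrrD !real_normK ?num_real// addrAC lerDl.
  by rewrite mulrn_wge0// mulr_ge0.
rewrite (le_lt_trans (ler_wsqrtr h))// sqrtr_sqr ger0_norm ?addr_ge0//.
by lra.
Qed.

(** At a zero of [f] the squared length of the gradient equals the discriminant, hence is positive.
    A step of k times the gradient gives the value k (1 + a k) |gradient|^2, which has the sign of k
    when k is small. *)
Lemma all_signs f q (V : set (Cplx R)) : proper_curve f -> value f q = 0 ->
  nbhs q V -> forall s, exists2 w, V w & Num.sg (value f w) = Num.sg s.
Proof.
move=> /proper_curveP; case: q => x y; rewrite valueE => nf fq qV s.
set a := coef f 0 in nf fq *; set b := coef f 1 in nf fq *.
set c := coef f 2 in nf fq *; set d := coef f 3 in nf fq *.
pose gx := 2 * a * x + b; pose gy := 2 * a * y + c.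
have G0 : 0 < gx ^+ 2 + gy ^+ 2.
  have -> : gx ^+ 2 + gy ^+ 2 = b ^+ 2 + c ^+ 2 - 4 * (a * d) +
    4 * a * (a * (x ^+ 2 + y ^+ 2) + b * x + c * y + d) by rewrite /gx /gy; ring.
  by rewrite fq mulr0 addr0 subr_gt0.
have step k : value f ((x +i* y) + k%:C * (gx +i* gy)) =
    k * (1 + a * k) * (gx ^+ 2 + gy ^+ 2).
  transitivity (a * (x ^+ 2 + y ^+ 2) + b * x + c * y + d +
    k * (1 + a * k) * (gx ^+ 2 + gy ^+ 2)); last by rewrite fq add0r.
  rewrite [(_ +i* _) + _](_ : _ = (x + k * gx) +i* (y + k * gy)); last first.
    by apply/eqP; rewrite eq_complex /= !mul0r subr0 addr0 !eqxx.
  by rewrite valueE -/a -/b -/c -/d /gx /gy; ring.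
have [->|s0] := eqVneq s 0.
  exists (x +i* y); first exact: nbhs_singleton qV.
  by rewrite valueE fq.
have [e e0 eV] := nbhs_ray ((Num.sg s)%:C * (gx +i* gy)) qV.
(* [t < e] keeps the point in [V], and |a| t < 1 keeps the factor 1 + a k positive. *)
pose t := Num.min (e / 2) (2 * (`|a| + 1))^-1.
have a1 : 0 < 2 * (`|a| + 1) by rewrite mulr_gt0// ltr_wpDl.
have t0 : 0 < t by rewrite lt_min divr_gt0//= invr_gt0.
have te : t < e by rewrite gt_min; apply/orP; left; lra.
have ta : `|a| * t < 1.
  have t1 : t <= (2 * (`|a| + 1))^-1 by rewrite ge_min lexx orbT.
  rewrite (le_lt_trans (ler_wpM2l (normr_ge0 _) t1))// ltr_pdivrMr//; lra.
exists ((x +i* y) + t%:C * ((Num.sg s)%:C * (gx +i* gy))).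
  by apply: eV; rewrite ltW.
rewrite mulrA -rmorphM step sgrM (gtr0_sg G0) mulr1 sgrM sgrM (gtr0_sg t0) mul1r.
rewrite sgr_id [X in _ * X](_ : _ = 1) ?mulr1// gtr0_sg//.
have s1 : `|Num.sg s| <= 1 by rewrite normr_sg; case: (s != 0).
have : `|a * (t * Num.sg s)| < 1.
  rewrite !normrM mulrA (le_lt_trans _ ta)// (gtr0_norm t0).
  by rewrite ler_piMr// mulr_ge0// ltW.
by rewrite ltr_norml => /andP[h _]; lra.
Qed.

Lemma near_sign g p : value g p != 0 ->
  nbhs p [set w | Num.sg (value g w) = Num.sg (value g p)].
Proof.
move=> gp; have := @continuous_value g p.
move=> /cvgrPdist_lt/(_ `|value g p|); rewrite normr_gt0 => /(_ gp).
apply: filterS => w /=; move: (value g w) => s; move: gp; move: (value g p) => t.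
case: (ltrgt0P t) => // t0 _; rewrite ltr_norml => /andP[h1 h2].
  by rewrite !gtr0_sg//; lra.
by rewrite !ltr0_sg//; lra.
Qed.

Lemma near_signs H p (D : set (seq Z)) :
  (forall A, A \in H -> D A.2 -> value A.2 p != 0) ->
  nbhs p [set w | forall A, A \in H -> D A.2 ->
    Num.sg (value A.2 w) = Num.sg (value A.2 p)].
Proof.
elim: H => [|A H IH] hD; first by apply: filterE => w A.
have [|DA] := pselect (D A.2); last first.
  have : nbhs p [set w | forall A, A \in H -> D A.2 ->
    Num.sg (value A.2 w) = Num.sg (value A.2 p)].
    by apply: IH => B BH; apply: hD; rewrite inE BH orbT.
  by apply: filterS => w h B; rewrite inE => /orP[/eqP->//|/h].
move=> DA; have Ap : value A.2 p != 0 by apply: hD; rewrite ?inE ?eqxx.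
have : nbhs p [set w | forall A, A \in H -> D A.2 ->
    Num.sg (value A.2 w) = Num.sg (value A.2 p)].
  by apply: IH => B BH; apply: hD; rewrite inE BH orbT.
apply: filterS2 (near_sign Ap) => w h1 h2 B.
by rewrite inE => /orP[/eqP->//|/h2].
Qed.

Lemma inside_sg H w p :
  (forall A, A \in H -> Num.sg (value A.2 w) = Num.sg (value A.2 p)) ->
  points H w = points H p.
Proof.
move=> h; rewrite /points /inside /=; congr is_true; apply: eq_in_all => A /h.
rewrite /holds /value => e; case: A.1.
  by rewrite -sgr_gt0 e sgr_gt0.
by rewrite -sgr_ge0 e sgr_ge0.
Qed.

Lemma boundary_on_curve H p : boundary (points H) p ->
  exists2 A, A \in H & value A.2 p = 0.
Proof.
move=> [cp ip]; apply: contrapT => noA.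
have := @near_signs H p setT.
have hA A : A \in H -> value A.2 p != 0.
  by move=> AH; apply/eqP => A0; apply: noA; exists A.
move=> /(_ (fun A AH _ => hA A AH)) np.
have {}np : nbhs p [set w | points H w = points H p].
  by apply: filterS np => w h; apply: inside_sg => A AH; exact: h.
have [w [Hw wp]] := cp _ np; apply: ip.
by apply: filterS np => v ->; rewrite -wp.
Qed.

(** A thin cell imposes both f >= 0 and -f >= 0, so several constraints may cut along one curve; [k]
    may be negative. *)
Definition same_curve f g := exists2 k : R, k != 0 &
  forall w, value g w = k * value f w.

(** Near p and near q every constraint off the curve of [f] keeps its sign, which is the same at
    both. By [all_signs] each sign of [f] occurs near q, so every membership pattern found near p is
    found near q, and conversely. *)
Lemma boundary_transfer f H p q : proper_curve f -> value f p = 0 ->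
  value f q = 0 ->
  (forall A, A \in H -> same_curve f A.2 \/ 0 < value A.2 p * value A.2 q) ->
  boundary (points H) p -> boundary (points H) q.
Proof.
move=> nf fp fq hpq [cp ip].
pose D := [set g | ~ same_curve f g].
have hD A : A \in H -> D A.2 -> 0 < value A.2 p * value A.2 q.
  by move=> /hpq[].
have h0 x y : 0 < x * y -> x != 0 /\ Num.sg x = Num.sg y.
  move=> xy; have : x != 0 by apply: contraTneq xy => ->; rewrite mul0r ltxx.
  case: (ltrgt0P x) xy => // x0; first by rewrite pmulr_rgt0// => y0; rewrite !gtr0_sg.
  by rewrite nmulr_rgt0// => y0; rewrite !ltr0_sg.
have np : nbhs p [set w | forall A, A \in H -> D A.2 ->
    Num.sg (value A.2 w) = Num.sg (value A.2 p)].
  by apply: near_signs => A AH DA; have [] := h0 _ _ (hD A AH DA).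
have nq : nbhs q [set w | forall A, A \in H -> D A.2 ->
    Num.sg (value A.2 w) = Num.sg (value A.2 q)].
  apply: near_signs => A AH DA; have := hD A AH DA; rewrite mulrC => /h0[].
  by [].
have transfer V w : nbhs q V -> (forall A, A \in H -> D A.2 ->
    Num.sg (value A.2 w) = Num.sg (value A.2 p)) ->
    exists2 w', V w' & points H w' = points H w.
  move=> qV hw; have [w' [Vw' hw'] sw'] := all_signs nf fq (filterI qV nq) (value f w).
  exists w' => //; apply: inside_sg => A AH.
  have [[k k0 kE]|DA] := pselect (same_curve f A.2).
    by rewrite !kE !sgrM sw'.
  by rewrite hw' // hw//; have [_ ->] := h0 _ _ (hD A AH DA).
split=> [V qV|iq].
  have [w [Hw hw]] := cp _ np; have [w' Vw' w'E] := transfer V w qV hw.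
  by exists w'; split=> //; rewrite w'E.
apply: ip; apply: filterS np => w hw.
by have [w' Hw' <-] := transfer _ w iq hw.
Qed.

End Boundary.

(** The hypotheses on [P] match the kinds of pieces of [gap_decomposition]. The last three keep the
    inclusion in [S], so that they can be refuted when [S] is bounded. *)
Lemma tame_image (R : realType) (M : Type) (P : set M -> Prop) (c : R -> M)
    (S : set R) (T : seq R) : closed S -> constant_off S T ->
  (forall a b, a <= b -> P (c @` [set t | a <= t <= b])) ->
  (forall a, (forall t, a <= t -> S t) -> P (c @` [set t | a <= t])) ->
  (forall b, (forall t, t <= b -> S t) -> P (c @` [set t | t <= b])) ->
  ((forall t, S t) -> P (c @` setT)) -> tame P (c @` S).
Proof.
move=> cS cT P1 P2 P3 P4.
pose T2 := [seq (a, b) | a <- T, b <- T].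
pose Q1 (i : R * R) := i.1 <= i.2 /\ forall t, i.1 <= t <= i.2 -> S t.
pose Q2 (a : R) := forall t, a <= t -> S t.
pose Q3 (b : R) := forall t, t <= b -> S t.
pose Q4 (i : bool) := forall t, S t.
have -> : c @` S =
    \bigcup_(i in [set i | i \in T2 /\ Q1 i]) c @` [set t | i.1 <= t <= i.2]
    `|` \bigcup_(a in [set a | a \in T /\ Q2 a]) c @` [set t | a <= t]
    `|` \bigcup_(b in [set b | b \in T /\ Q3 b]) c @` [set t | t <= b]
    `|` \bigcup_(i in [set i | i \in [:: true] /\ Q4 i]) c @` setT.
  apply/seteqP; split=> [_ [x Sx <-]|y].
    have [[a [b [aT bT ab h]]]|[a [aT ax h]]|[b [bT xb h]]|h] :=
      gap_decomposition cS cT Sx.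
    - do 3 left; exists (a, b); last by exists x.
      split; first by apply/allpairsP; exists (a, b).
      by split=> //=; case/andP: ab; exact: le_trans.
    - by do 2 left; right; exists a => //; exists x.
    - by left; right; exists b => //; exists x.
    - by right; exists true => //; exists x.
  case=> [[[|]|]|] [i [_ h] [x xi <-]]; exists x => //.
  - by case: h => _; apply.
  - exact: h.
  - exact: h.
apply: tameU; first apply: tameU; first apply: tameU.
- by apply: tame_seq => -[a b] _ [ab _]; apply/tame1/P1.
- by apply: tame_seq => a _ h; apply/tame1/P2.
- by apply: tame_seq => b _ h; apply/tame1/P3.
- by apply: tame_seq => b _ h; apply/tame1/P4.
Qed.

(** * Lines and circles, and where other curves cross them *)

Section Curves.
Variable R : realType.
Implicit Types (f g : seq Z) (H : region) (w p q : Cplx R) (t x y u : R).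

Notation coef f i := (zval R (nth Z0 f i)).

Lemma quadratic_zeros (a b c : R) : [|| a != 0, b != 0 | c != 0] ->
  exists s : seq R, forall u, a * u ^+ 2 + b * u + c = 0 -> u \in s.
Proof.
have [->|a0] := eqVneq a 0; last first.
  move=> _; exists [:: (- b + Num.sqrt (b ^+ 2 - 4 * a * c)) / (2 * a);
    (- b - Num.sqrt (b ^+ 2 - 4 * a * c)) / (2 * a)] => u h.
  (* A root makes the discriminant a square, so [Num.sqrt] does not return its default value for
     negative arguments. *)
  have e : (2 * a * u + b) ^+ 2 = b ^+ 2 - 4 * a * c.
    have -> : (2 * a * u + b) ^+ 2 =
      4 * a * (a * u ^+ 2 + b * u + c) + (b ^+ 2 - 4 * a * c) by ring.
    by rewrite h mulr0 add0r.
  have a2 : 2 * a != 0 by rewrite mulf_neq0.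
  have : (2 * a * u + b) ^+ 2 == Num.sqrt (b ^+ 2 - 4 * a * c) ^+ 2.
    by rewrite sqr_sqrtr -e ?sqr_ge0.
  rewrite eqf_sqr !inE => /orP[] /eqP h1; apply/orP; [left|right];
    by apply/eqP; rewrite -h1; field.
have [->|b0] := eqVneq b 0; rewrite /= => h.
  by exists [::] => u; rewrite !mul0r !add0r => c0; rewrite c0 eqxx in h.
exists [:: - c / b] => u; rewrite mul0r add0r inE => e; apply/eqP.
have -> : c = - (b * u) by apply/eqP; rewrite -addr_eq0 addrC e.
by field.
Qed.

Lemma same_curveP f g (k : R) : proper_curve g ->
  (forall w, value g w = k * value f w) -> same_curve R f g.
Proof.
move=> ng gf; exists k => //; apply/eqP => k0.
have g0 : value g (0 : Cplx R) = 0 by rewrite gf k0 mul0r.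
have [w _] := all_signs ng g0 filterT 1.
by rewrite gf k0 mul0r sgr0 sgr1 => /esym/eqP; rewrite oner_eq0.
Qed.

Lemma closed_boundary (M : topologicalType) (A : set M) : closed (boundary A).
Proof.
by rewrite /boundary setDE; apply: closedI; [exact: closed_closure |
  apply: open_closedC; exact: open_interior].
Qed.

(** Unless [T] is met between x and y, no constraint off the curve can change sign there, by the
    intermediate value theorem; boundary membership is then transferred from one end to the
    other. *)
Lemma constant_boundary (c : R -> Cplx R) (I : set R) (T : seq R) f H :
  continuous c -> (forall t, value f (c t) = 0) -> proper_curve f ->
  constant_off I T ->
  (forall A, A \in H -> same_curve R f A.2 \/
    forall t, I t -> value A.2 (c t) = 0 -> t \in T) ->
  constant_off [set t | I t /\ boundary (points H) (c t)] T.
Proof.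
move=> cc fc nf IT HT x y xy [Ix bx]; split; first exact: IT xy Ix.
have It t : Num.min x y <= t <= Num.max x y -> I t.
  move=> /andP[t1 t2]; apply: (IT x) Ix => u uT /andP[u1 u2]; apply: (xy u uT).
  apply/andP; split.
    by apply: le_trans u1; rewrite le_min t1 ge_min lexx.
  by apply: (le_trans u2); rewrite ge_max t2 le_max lexx.
apply: (boundary_transfer nf (fc x) (fc y)) bx => A AH; have [|h] := HT A AH; [by left | right].
rewrite ltNge; apply/negP => le0.
pose F t := value A.2 (c t).
have cF : continuous F.
  by move=> t; apply: continuous_comp; [exact: cc | exact: continuous_value].
have xyM : Num.min x y <= Num.max x y by rewrite le_max ge_min lexx.
have [|u + Fu] := @IVT R F _ _ 0 xyM (continuous_subspaceT cF).
  rewrite ge_min le_max; have : F (Num.min x y) * F (Num.max x y) <= 0.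
    by rewrite minEle maxEle; case: (leP x y) => _ //; rewrite mulrC.
  move: (F _) (F _) => s r; clear.
  case: (lerP s 0) => s0; case: (lerP 0 s) => s1; case: (lerP r 0) => r0;
    case: (lerP 0 r) => r1 //= sr; exfalso; nra.
by rewrite in_itv /= => uxy; apply: (xy u _ uxy); apply: h => //; exact: It.
Qed.

End Curves.

Section RegionBoundary.
Variable R : realType.
Implicit Types (f g : seq Z) (H : region) (w p q : Cplx R) (t x y u : R).

Notation coef f i := (zval R (nth Z0 f i)).

Definition line_or_arc (L : set (Cplx R)) :=
  [\/ is_line L, is_half_line L, is_segment L | is_arc L].

Lemma all_zeros (I : set R) (c : R -> Cplx R) f H :
  (forall g, proper_curve g -> exists T : seq R, same_curve R f g \/
    forall t, I t -> value g (c t) = 0 -> t \in T) ->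
  (forall A, A \in H -> proper_curve A.2) ->
  exists T : seq R, forall A, A \in H -> same_curve R f A.2 \/
    forall t, I t -> value A.2 (c t) = 0 -> t \in T.
Proof.
move=> hg; elim: H => [|A H IH] hH; first by exists [::].
have [|T hT] := IH; first by move=> B BH; apply: hH; rewrite inE BH orbT.
have [|T' hT'] := hg A.2; first by apply: hH; rewrite inE eqxx.
exists (T' ++ T) => B; rewrite inE => /orP[/eqP->|/hT].
  case: hT' => [|h]; [by left | right => t It /(h t It)].
  by rewrite mem_cat => ->.
case=> [|h]; [by left | right => t It /(h t It)].
by rewrite mem_cat orbC => ->.
Qed.

Section Line.
Variable f : seq Z.
Hypotheses (f_proper : proper_curve f) (f_line : coef f 0 = 0).
Let b := coef f 1.
Let c := coef f 2.
Let d := coef f 3.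

Definition line_norm := coef f 1 ^+ 2 + coef f 2 ^+ 2.
(** The foot of the perpendicular from the origin. *)
Definition line_point : Cplx R :=
  (- (coef f 3 * coef f 1) / line_norm) +i* (- (coef f 3 * coef f 2) / line_norm).
Definition line_dir : Cplx R := (- coef f 2) +i* coef f 1.
Definition line_at t : Cplx R := line_point + t%:C * line_dir.

Lemma line_norm_gt0 : 0 < line_norm.
Proof. by have := @proper_curveP R _ f_proper; rewrite f_line mul0r mulr0. Qed.

Lemma line_atE t : line_at t =
  (- (d * b) / line_norm - t * c) +i* (- (d * c) / line_norm + t * b).
Proof.
by apply/eqP; rewrite eq_complex /= !mul0r subr0 addr0 mulrN !eqxx.
Qed.

Lemma line_dir_neq0 : line_dir != 0.
Proof.
apply/eqP => -[/eqP b0 c0]; move: line_norm_gt0; rewrite /line_norm.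
by move: b0; rewrite oppr_eq0 => /eqP->; rewrite c0 expr0n /= addr0 ltxx.
Qed.

Lemma continuous_line : continuous line_at.
Proof.
have -> : line_at = fun t =>
  ((- (d * b) / line_norm - t * c) +i* (- (d * c) / line_norm + t * b)) : Cplx R.
  by apply/funext => t; exact: line_atE.
move=> t; apply: (@continuous_pair R R (fun t => _) (fun t => _) t).
  exact: cvgB (cvg_cst _) (cvgM cvg_id (cvg_cst _)).
exact: cvgD (cvg_cst _) (cvgM cvg_id (cvg_cst _)).
Qed.

Lemma value_line t : value f (line_at t) = 0.
Proof.
rewrite line_atE valueE f_line mul0r add0r -/b -/c -/d.
have n0 : line_norm != 0 by rewrite gt_eqF// line_norm_gt0.
have -> : b * (- (d * b) / line_norm - t * c) + c * (- (d * c) / line_norm + t * b) + d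
  = d - d * ((b ^+ 2 + c ^+ 2) / line_norm) by ring.
by rewrite divff// mulr1 subrr.
Qed.

Lemma line_surj w : value f w = 0 -> exists t, w = line_at t.
Proof.
case: w => x y; rewrite valueE f_line mul0r add0r -/b -/c -/d => h.
have n0 : line_norm != 0 by rewrite gt_eqF// line_norm_gt0.
have nE : line_norm = b ^+ 2 + c ^+ 2 by [].
have dE : d = - (b * x + c * y) by apply/eqP; rewrite -addr_eq0 addrC h.
exists ((b * y - c * x) / line_norm); rewrite line_atE dE.
rewrite nE in n0 *.
by apply/eqP; rewrite eq_complex /=; apply/andP; split; apply/eqP; field.
Qed.

(** On the line [g] is a polynomial of degree at most two in the parameter. If it vanishes
    identically, [g] is [f] times (b' b + c' c) / (b^2 + c^2), where (b, c) and (b', c') are the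
    linear coefficients of [f] and [g]. *)
Lemma line_zeros g : proper_curve g -> exists T : seq R, same_curve R f g \/
  forall t, True -> value g (line_at t) = 0 -> t \in T.
Proof.
move=> gP; pose n := line_norm; have n0 : n != 0 by rewrite gt_eqF// line_norm_gt0.
have nE : n = b ^+ 2 + c ^+ 2 by [].
pose a' := coef g 0; pose b' := coef g 1; pose c' := coef g 2; pose d' := coef g 3.
pose C0 := a' * (d ^+ 2 / n) - (b' * b + c' * c) * (d / n) + d'.
have gE t : value g (line_at t) =
    (a' * n) * t ^+ 2 + (c' * b - b' * c) * t + C0.
  rewrite line_atE valueE -/a' -/b' -/c' -/d' -/n /C0; rewrite nE in n0 *.
  by field.
have [/quadratic_zeros[s sP]|] :=
  boolP [|| a' * n != 0, c' * b - b' * c != 0 | C0 != 0].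
  by exists s; right=> t _; rewrite gE; exact: sP.
rewrite !negb_or !negbK mulf_eq0 (negbTE n0) orbF => /and3P[/eqP a0 /eqP e1 /eqP e2].
exists [::]; left; apply: (@same_curveP R f g ((b' * b + c' * c) / n)) => // -[x y].
have {}e2 : d' = (b' * b + c' * c) / n * d.
  by apply/eqP; rewrite -subr_eq0 -e2 /C0 a0; apply/eqP; ring.
have e3 : b' = (b' * b + c' * c) / n * b.
  apply: (mulIf n0); rewrite mulrAC divfK// nE.
  have -> : (b' * b + c' * c) * b = b' * (b ^+ 2 + c ^+ 2) + c * (c' * b - b' * c) by ring.
  by rewrite e1 mulr0 addr0.
have e4 : c' = (b' * b + c' * c) / n * c.
  apply: (mulIf n0); rewrite mulrAC divfK// nE.
  have -> : (b' * b + c' * c) * c = c' * (b ^+ 2 + c ^+ 2) - b * (c' * b - b' * c) by ring.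
  by rewrite e1 mulr0 subr0.
rewrite !valueE f_line -/a' -/b' -/c' -/d' -/b -/c -/d a0 e2.
move: e3 e4; set k := _ / n => -> ->; ring.
Qed.

Lemma line_at_convex x y t :
  line_at ((1 - t) * x + t * y) = (1 - t)%:C * line_at x + t%:C * line_at y.
Proof.
by rewrite !line_atE; apply/eqP; rewrite eq_complex /=; apply/andP; split;
  apply/eqP; ring.
Qed.

Lemma line_at_shift x t : line_at (x + t) = line_at x + t%:C * line_dir.
Proof. by rewrite /line_at rmorphD mulrDl addrA. Qed.

Lemma line_pieces H : (forall A, A \in H -> proper_curve A.2) ->
  tame line_or_arc (line_at @` [set t | True /\ boundary (points H) (line_at t)]).
Proof.
move=> HP; have [T hT] := all_zeros line_zeros HP.
apply: (tame_image (T := T)).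
- apply: closedI; first exact: closedT.
  by apply: preimage_closed => [t _|]; [exact: continuous_line | exact: closed_boundary].
- exact: constant_boundary continuous_line value_line f_proper (fun _ _ _ _ => I) hT.
- move=> x y xy; apply: Or43; exists (line_at x), (line_at y).
  apply/seteqP; split=> [_ [t /andP[xt ty] <-]|_ [t /andP[t0 t1] ->]]; last first.
    exists ((1 - t) * x + t * y); last exact: line_at_convex.
    have h1 := mulr_ge0 t0 (ltac:(lra) : 0 <= y - x).
    have h2 : 0 <= (1 - t) * (y - x) by apply: mulr_ge0; lra.
    by apply/andP; split; lra.
  have [e|xy'] := eqVneq x y.
    exists 0; rewrite ?lexx ?ler01// -line_at_convex; congr line_at.
    by rewrite -e in ty; rewrite subr0 mul1r mul0r addr0; lra.
  have yx : 0 < y - x by rewrite subr_gt0 lt_neqAle xy'.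
  exists ((t - x) / (y - x)); last first.
    by rewrite -line_at_convex; congr line_at; field; rewrite gt_eqF.
  by rewrite divr_ge0 ?subr_ge0//= ler_pdivrMr// mul1r lerB.
- move=> x _; apply: Or42; exists (line_at x), line_dir; split; first exact: line_dir_neq0.
  apply/seteqP; split=> [_ [t xt <-]|_ [t t0 ->]].
    by exists (t - x); rewrite ?subr_ge0// -line_at_shift addrC subrK.
  by exists (x + t); rewrite ?line_at_shift//= lerDl.
- move=> x _; apply: Or42; exists (line_at x), (- line_dir); split.
    by rewrite oppr_eq0 line_dir_neq0.
  apply/seteqP; split=> [_ [t tx <-]|_ [t t0 ->]].
    exists (x - t); rewrite ?subr_ge0// mulrN -mulNr -rmorphN -line_at_shift.
    by rewrite opprB addrC subrK.
  exists (x - t); first by rewrite /= gerBl.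
  by rewrite line_at_shift rmorphN mulrN mulNr.
- move=> _; apply: Or41; exists line_point, line_dir; split; first exact: line_dir_neq0.
  by apply/seteqP; split=> [_ [t _ <-]|_ [t ->]]; exists t.
Qed.

Lemma line_boundary H : (forall A, A \in H -> proper_curve A.2) ->
  tame line_or_arc ([set w | value f w = 0] `&` boundary (points H)).
Proof.
move=> /line_pieces; congr tame; apply/seteqP; split=> [_ [t [_ bt] <-]|w [fw bw]].
  by split=> //; exact: value_line.
by have [t wE] := line_surj fw; exists t; [split; [|rewrite -wE] | rewrite -wE].
Qed.

End Line.

Section Circle.
Variable f : seq Z.
Hypotheses (f_proper : proper_curve f) (f_circle : coef f 0 != 0).
Let a := coef f 0.
Let b := coef f 1.
Let c := coef f 2.
Let d := coef f 3.

Definition center_x := - coef f 1 / (2 * coef f 0).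
Definition center_y := - coef f 2 / (2 * coef f 0).
Definition radius := Num.sqrt
  ((coef f 1 ^+ 2 + coef f 2 ^+ 2 - 4 * (coef f 0 * coef f 3)) / (2 * coef f 0) ^+ 2).
Definition circle_at t : Cplx R :=
  (center_x +i* center_y) + radius%:C * (cos t +i* sin t).
Definition full_turn : set R := [set t | - pi <= t <= pi].

Lemma radius_gt0 : 0 < radius.
Proof.
rewrite sqrtr_gt0 divr_gt0//; first by rewrite subr_gt0 proper_curveP.
by rewrite lt_neqAle sqr_ge0 eq_sym expf_neq0// mulf_neq0.
Qed.

Lemma radius_sqr : radius ^+ 2 = (b ^+ 2 + c ^+ 2 - 4 * (a * d)) / (2 * a) ^+ 2.
Proof.
rewrite sqr_sqrtr// divr_ge0 ?sqr_ge0// subr_ge0.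
by apply: ltW; exact: proper_curveP.
Qed.

Lemma circle_atE t : circle_at t =
  (center_x + radius * cos t) +i* (center_y + radius * sin t).
Proof. by apply/eqP; rewrite eq_complex /= !mul0r subr0 addr0 !eqxx. Qed.

Lemma continuous_circle : continuous circle_at.
Proof.
have -> : circle_at = fun t =>
  ((center_x + radius * cos t) +i* (center_y + radius * sin t)) : Cplx R.
  by apply/funext => t; exact: circle_atE.
move=> t; apply: (@continuous_pair R R (fun t => _) (fun t => _) t).
  exact: cvgD (cvg_cst _) (cvgM (cvg_cst _) (@continuous_cos R t)).
exact: cvgD (cvg_cst _) (cvgM (cvg_cst _) (@continuous_sin R t)).
Qed.

Lemma value_circle x y : value f (x +i* y) =
  a * ((x - center_x) ^+ 2 + (y - center_y) ^+ 2 - radius ^+ 2).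
Proof.
rewrite valueE -/a -/b -/c -/d radius_sqr /center_x /center_y -/a -/b -/c.
by field; rewrite /a f_circle.
Qed.

Lemma value_circle_at t : value f (circle_at t) = 0.
Proof.
rewrite circle_atE value_circle [X in a * X](_ : _ = 0) ?mulr0//.
transitivity (radius ^+ 2 * (cos t ^+ 2 + sin t ^+ 2 - 1)); first by ring.
by rewrite cos2Dsin2 subrr mulr0.
Qed.

Lemma circle_surj w : value f w = 0 -> exists2 t, full_turn t & w = circle_at t.
Proof.
case: w => x y; rewrite value_circle => /eqP; rewrite mulf_eq0 (negbTE f_circle) /=.
rewrite subr_eq0 => /eqP h; pose z : Cplx R := (x - center_x) +i* (y - center_y).
have zr : Normc.normc z = radius by rewrite /= h sqrtr_sqr ger0_norm ?ltW ?radius_gt0.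
have z0 : z != 0.
  apply/eqP => z0; have := radius_gt0.
  by rewrite -zr z0 /= expr0n addr0 sqrtr0 ltxx.
have [t1 t2] := argP z0; rewrite zr /= => xE yE.
exists (arg z); first by rewrite /full_turn /= ltW.
by rewrite circle_atE -xE -yE ![_ + (_ - _)]addrC !subrK.
Qed.

Lemma cos_full_turn t u : full_turn t -> cos t = u -> t \in [:: acos u; - acos u].
Proof.
move=> /andP[t1 t2] <-; rewrite !inE; have [t0|t0] := lerP 0 t.
  by rewrite cosK ?eqxx// in_itv /= t0.
by rewrite cosKN ?opprK ?eqxx ?orbT// t1 ltW.
Qed.

(** Eliminating the sine by squaring gives a quadratic equation for cos t. Squaring may add roots,
    which is harmless because [T] only has to contain the zeros. *)
Lemma trig_zeros (k l m : R) : (k != 0) || (l != 0) -> exists T : seq R,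
  forall t, full_turn t -> k * cos t + l * sin t + m = 0 -> t \in T.
Proof.
move=> kl; have kl0 : k ^+ 2 + l ^+ 2 != 0.
  by rewrite paddr_eq0 ?sqr_ge0// !sqrf_eq0 negb_and.
have [|s sP] := @quadratic_zeros R (k ^+ 2 + l ^+ 2) (2 * k * m) (m ^+ 2 - l ^+ 2).
  by rewrite kl0.
exists (flatten [seq [:: acos u; - acos u] | u <- s]) => t tI h.
apply/flattenP; exists [:: acos (cos t); - acos (cos t)]; last exact: cos_full_turn.
apply/mapP; exists (cos t) => //; apply: sP.
have e : l * sin t = - (k * cos t + m).
  by apply/eqP; rewrite -subr_eq0 opprK; apply/eqP; rewrite -[RHS]h; ring.
transitivity (l ^+ 2 * (cos t ^+ 2 + sin t ^+ 2 - 1) + (k * cos t + m) ^+ 2 - (l * sin t) ^+ 2).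
  by ring.
by rewrite cos2Dsin2 e; ring.
Qed.

(** Subtracting a multiple of [f] removes the quadratic part of [g]; on the circle [g] is then an
    affine function of cos t and sin t. *)
Lemma circle_zeros g : proper_curve g -> exists T : seq R, same_curve R f g \/
  forall t, full_turn t -> value g (circle_at t) = 0 -> t \in T.
Proof.
move=> gP; have [k kE] : exists k, coef g 0 = k * a.
  by exists (coef g 0 / a); rewrite divfK.
pose b' := coef g 1 - k * b; pose c' := coef g 2 - k * c; pose d' := coef g 3 - k * d.
have gE x y : value g (x +i* y) = k * value f (x +i* y) + (b' * x + c' * y + d').
  rewrite !valueE -/a -/b -/c -/d kE.
  by rewrite /b' /c' /d'; ring.
have [bc|] := boolP ((b' != 0) || (c' != 0)).
  have [|T TP] := @trig_zeros (radius * b') (radius * c')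
    (b' * center_x + c' * center_y + d').
    by rewrite !mulf_eq0 !(gt_eqF radius_gt0).
  exists T; right=> t tI; rewrite circle_atE gE -circle_atE value_circle_at mulr0 add0r => h.
  by apply: TP => //; rewrite -[RHS]h; ring.
rewrite negb_or !negbK => /andP[/eqP b0 /eqP c0].
have {}gE w : value g w = k * value f w + d'.
  by case: w => x y; rewrite gE b0 c0 !mul0r !add0r.
exists [::]; have [d0|d0] := eqVneq d' 0.
  by left; apply: (@same_curveP R f g k) => // w; rewrite gE d0 addr0.
by right=> t _; rewrite gE value_circle_at mulr0 add0r => /eqP; rewrite (negbTE d0).
Qed.

Lemma circle_pieces H : (forall A, A \in H -> proper_curve A.2) ->
  tame line_or_arc
    (circle_at @` [set t | full_turn t /\ boundary (points H) (circle_at t)]).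
Proof.
move=> HP; have [T hT] := all_zeros circle_zeros HP.
have pi0 := pi_gt0 R.
(* The ends of the parameter interval are break points too. As the interval is bounded, the
   unbounded kinds of pieces are refuted. *)
apply: (tame_image (T := [:: - pi, pi & T])).
- apply: closedI.
    have -> : full_turn = `[- pi, pi]%classic by apply/seteqP; split=> t; rewrite /= in_itv.
    exact: interval_closed.
  by apply: preimage_closed => [t _|]; [exact: continuous_circle | exact: closed_boundary].
- apply: constant_boundary continuous_circle value_circle_at f_proper _ _.
    move=> x y xy /andP[x1 x2]; rewrite /full_turn /=.
    have h1 := xy (- pi); have h2 := xy pi.
    move: h1 h2; rewrite !inE !eqxx orbT !ge_min !le_max => /(_ isT) h1 /(_ isT) h2.
    rewrite !leNgt; apply/andP; split; apply/negP => h.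
      by apply: h1; rewrite (ltW h) x1 !orbT.
    by apply: h2; rewrite (ltW h) x2 !orbT.
  move=> A AH; have [|h] := hT A AH; [by left | right => t tI /(h t tI) tT].
  by rewrite !inE tT !orbT.
- move=> x y xy; apply: Or44; exists (center_x +i* center_y), radius, x, y.
  split=> //; first exact: radius_gt0.
  by apply/seteqP; split=> [_ [t txy <-]|_ [t txy ->]]; exists t.
- move=> x h; have [] := h (Num.max x (pi + 1)); rewrite ?le_max ?lexx//.
  by move=> /andP[_]; rewrite ge_max => /andP[_]; lra.
- move=> x h; have [] := h (Num.min x (- pi - 1)); rewrite ?ge_min ?lexx//.
  by move=> /andP[+ _]; rewrite le_min => /andP[_]; lra.
- move=> h; have [] := h (pi + 1).
  by move=> /andP[_]; lra.
Qed.

Lemma circle_boundary H : (forall A, A \in H -> proper_curve A.2) ->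
  tame line_or_arc ([set w | value f w = 0] `&` boundary (points H)).
Proof.
move=> /circle_pieces; congr tame; apply/seteqP; split=> [_ [t [_ bt] <-]|w [fw bw]].
  by split=> //; exact: value_circle_at.
by have [t tI wE] := circle_surj fw; exists t; [split; [|rewrite -wE] | rewrite -wE].
Qed.

End Circle.

Lemma region_boundary H : (forall A, A \in H -> proper_curve A.2) ->
  bounded_by_lines_and_arcs (points H : set (Cplx R)).
Proof.
move=> HP; suff : tame line_or_arc (boundary (points H)) by [].
have -> : boundary (points H) = \bigcup_(A in [set A | A \in H /\ True])
    ([set w : Cplx R | value A.2 w = 0] `&` boundary (points H)).
  apply/seteqP; split=> [w bw|w [A _ []]//].
  by have [A AH Aw] := boundary_on_curve bw; exists A.
apply: tame_seq => A AH _; have AP := HP A AH.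
have [A0|A0] := eqVneq (coef A.2 0) 0; first exact: line_boundary.
exact: circle_boundary.
Qed.

End RegionBoundary.

(** * Connectedness *)

(** Then f >= 0 is a disk or a half-plane, possibly degenerate. *)
Definition convex_form (f : seq Z) : bool := Z.leb (nth Z0 f 0) 0.

(* The derivative of the form along the translation by [(i, j)]. *)
Definition drift (i j : Z) (f : seq Z) : seq Z :=
  let n := nth Z0 f in
  [:: 0; 2 * n 0%N * i; 2 * n 0%N * j; n 1%N * i + n 2%N * j]%coqZ.

(** Meaningful for forms without quadratic part; [connects] tests [far] for this. *)
Definition translate (i j : Z) (f : seq Z) : seq Z :=
  let n := nth Z0 f in
  [:: 0; n 1%N; n 2%N; n 1%N * i + n 2%N * j + n 3%N]%coqZ.

(* The derivative of the form at [p] along [-1 - p]. *)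
Definition star_drift (f : seq Z) : seq Z :=
  let n := nth Z0 f in
  [:: - (2 * n 0%N); - (2 * n 0%N + n 1%N); - n 2%N; - n 1%N]%coqZ.

Definition star_value (f : seq Z) : Z :=
  let n := nth Z0 f in (n 0%N - n 1%N + n 3%N)%coqZ.

(* Reasons for a region to be connected: it is convex; each of its points can
   be moved by one of the given vectors into a convex part; it is star-shaped
   about [-1]; it is the image of a connected region under [z |-> 1/z]. *)
Inductive reason :=
  | Convex
  | Drift of seq (Z * Z) & constraint
  | Star
  | Inverse of region & reason.

(* The half squares above [i] and below [-i]. *)
Definition shifted_voids : seq region :=
  [:: pull (iter 3 pull_rot) (pull pull_sub1 half_square_void);
      pull pull_rot (pull pull_sub1 (pull (iter 3 pull_rot) half_square_void))].

Definition connecting_voids : seq region :=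
  fibre_voids ++ shifted_voids ++
  rotations (one_void :: corner_void :: square_voids) ++ [:: origin_void].

Definition nonzero : constraint := gt 1 0 0 0.

Fixpoint connects (P : reason) (r : region) : bool :=
  match P with
  | Convex => all (fun A => convex_form A.2) r
  | Drift dirs far =>
    if all (fun A : constraint => Z.leb 0 (nth Z0 A.2 0)) r &&
       Z.eqb (nth Z0 far.2 0) 0
    then
        covered 4 (finite_pt ++ far :: [seq A <- r | Z.eqb (nth Z0 A.2 0) 0])
          (connecting_voids ++ [:: r]) &&
        covered 4 (finite_pt ++ r) (connecting_voids ++
          [seq (far.1, translate v.1 v.2 far.2) ::
               [seq (false, drift v.1 v.2 A.2) | A <- r] | v <- dirs])
    else false
  | Star =>
    if all (fun A : constraint => if A.1 then Z.ltb 0 (star_value A.2)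
                  else Z.leb 0 (star_value A.2)) r
    then covered 4 (finite_pt ++ r) (connecting_voids ++
      [:: [seq (false, star_drift A.2) | A <- r & ~~ convex_form A.2]])
    else false
  | Inverse H P =>
    if connects P H then [&&
        covered 4 (finite_pt ++ r)
          (connecting_voids ++ [:: nonzero :: pull pull_inv H]),
        covered 4 (finite_pt ++ nonzero :: pull pull_inv H)
          (connecting_voids ++ [:: r]) &
        covered 4 (finite_pt ++ H) (connecting_voids ++ [:: [:: nonzero]])]
    else false
  end.

(** Aimed at unbounded fibres in Re z <= 1/2: a shift by -3 brings them to Re z <= -1, clear of all
    the removed unit disks. The slanted vectors serve points from which a horizontal move would
    approach a removed disk. *)
Definition drift_left : reason :=
  Drift [:: (-3, 0); (-3, 3); (-3, -3)]%coqZ (ge 0 (-1) 0 (-1)).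
(** The disk |w|^2 < x + y, removed from [strip_up], lies in x + y <= 2; the vector runs along the
    strip and carries x + y > 1 beyond 2. *)
Definition drift_up : reason := Drift [:: (1, 1)%coqZ] (gt 0 1 1 (-2)).
Definition drift_down : reason := Drift [:: (1, -1)%coqZ] (gt 0 1 (-1) (-2)).
(** [strip_up] with its side y = x - 1 added, because [cusp_down], its image under reciprocals,
    contains the arc |w|^2 = x + y. *)
Definition half_closed_strip : region :=
  [:: ge 0 (-1) 1 1; gt 0 1 (-1) 0; ge 1 (-1) (-1) 0; gt 0 1 1 (-1)].

(** The [Inverse] entries are meant for [cusp_up], [cusp_down], [inner_arc] and [outer_arc], in this
    order. *)
Definition reasons : seq reason :=
  [:: Convex; drift_left; Star; drift_up; drift_down;
      Inverse strip_down.1 drift_down; Inverse half_closed_strip drift_up;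
      Inverse ray_down.1 Convex; Inverse edge.1 Convex].

Definition connected_check : bool :=
  all (fun r => find (fun P => connects P r) reasons < size reasons)%N
    (undup (flatten [seq c.1 :: c.2 | c <- cells])).

Lemma connected_checkT : connected_check.
Proof. by vm_compute. Qed.

(** * Soundness of the connectedness certificates *)

Section Connected.
Variable R : realType.
Implicit Types (f : seq Z) (r H : region) (p q w : Cplx R) (t x y : R).

Notation coef f i := (zval R (nth Z0 f i)).

Definition toward p q t : Cplx R :=
  (complex.Re p + t * (complex.Re q - complex.Re p)) +i*
  (complex.Im p + t * (complex.Im q - complex.Im p)).

Lemma toward0 p q : toward p q 0 = p.
Proof. by case: p => x y; rewrite /toward !mul0r !addr0. Qed.

Lemma toward1 p q : toward p q 1 = q.
Proof. by case: q => x y; rewrite /toward !mul1r /= ![_ + (_ - _)]addrC !subrK. Qed.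

Lemma continuous_toward p q : continuous (toward p q).
Proof.
by move=> t; apply: (@continuous_pair R R (fun t => _) (fun t => _) t);
  exact: cvgD (cvg_cst _) (cvgM cvg_id (cvg_cst _)).
Qed.

Lemma connected_hub (A C : set (Cplx R)) : C `<=` A ->
  (forall p q t, C p -> C q -> 0 <= t <= 1 -> C (toward p q t)) ->
  (forall p, A p -> exists2 q, C q & forall t, 0 <= t <= 1 -> A (toward p q t)) ->
  connected A.
Proof.
move=> CA cC AC; have [->|/set0P[p0 /AC[c Cc _]]] := eqVneq A set0.
  exact: connected0.
pose seg p q := toward p q @` `[0, 1].
have cseg p q : connected (seg p q).
  apply: connected_continuous_connected; first exact: segment_connected.
  exact/continuous_subspaceT/continuous_toward.
have segl p q : seg p q p by exists 0; rewrite ?toward0//= in_itv /= lexx ler01.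
have segr p q : seg p q q by exists 1; rewrite ?toward1//= in_itv /= lexx ler01.
pose q_ p := if pselect (A p) is left Ap then projT1 (cid2 (AC p Ap)) else p.
have q_P p : A p -> C (q_ p) /\ forall t, 0 <= t <= 1 -> A (toward p (q_ p) t).
  by rewrite /q_; case: pselect => // Ap _; case: cid2.
have -> : A = \bigcup_(p in A) (seg p (q_ p) `|` seg (q_ p) c).
  apply/seteqP; split=> [p Ap|_ [p /q_P[Cq Aq] [[t +]|[t +]] <-]].
  - by exists p => //; left.
  - by rewrite /= in_itv; exact: Aq.
  - by rewrite /= in_itv => t01; apply/CA/cC.
apply: bigcup_connected; first by exists c => p _; right.
move=> p _; apply: connectedU => //.
by exists (q_ p).
Qed.

Lemma value_toward f p q t : value f (toward p q t) =
  (1 - t) * value f p + t * value f q - coef f 0 * (t * (1 - t)) *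
    ((complex.Re q - complex.Re p) ^+ 2 + (complex.Im q - complex.Im p) ^+ 2).
Proof. by case: p => x y; case: q => x' y'; rewrite /toward !valueE /=; ring. Qed.

Lemma holds_value (A : constraint) w : holds (qseq (qpoint w)) A =
  if A.1 then 0 < value A.2 w else 0 <= value A.2 w.
Proof. by []. Qed.

Lemma zval_le0 (a : Z) : Z.leb a 0 -> zval R a <= 0.
Proof. by case: a => // p _; rewrite /zval lerz0. Qed.

Lemma zval_ge0 (a : Z) : Z.leb 0 a -> 0 <= zval R a.
Proof. by case: a => // p _; rewrite /zval ler0z. Qed.

Lemma holds_convex A p q t : convex_form A.2 -> 0 <= t <= 1 ->
  holds (qseq (qpoint p)) A -> holds (qseq (qpoint q)) A ->
  holds (qseq (qpoint (toward p q t))) A.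
Proof.
move=> /zval_le0 a0 /andP[t0 t1]; rewrite !holds_value value_toward.
have n0 : 0 <= - coef A.2 0 * (t * (1 - t)) *
    ((complex.Re q - complex.Re p) ^+ 2 + (complex.Im q - complex.Im p) ^+ 2).
  apply: mulr_ge0; last by apply: addr_ge0; exact: sqr_ge0.
  by apply: mulr_ge0; [lra | apply: mulr_ge0; lra].
move: n0; rewrite !mulNr; set e := _ * _ * _ => e0.
have h (u v : R) : 0 <= u -> 0 <= v -> 0 <= (1 - t) * u + t * v.
  by move=> u0 v0; apply: addr_ge0; apply: mulr_ge0 => //; lra.
case: A.1 => pA qA; last by have := h _ _ pA qA; lra.
have [t2|t2] := ltrP t 1.
  have h1 : 0 < (1 - t) * value A.2 p by apply: mulr_gt0 => //; lra.
  have h2 : 0 <= t * value A.2 q by apply: mulr_ge0 => //; lra.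
  by lra.
have h1 : 0 <= (1 - t) * value A.2 p by apply: mulr_ge0; lra.
have h2 : 0 < t * value A.2 q by apply: mulr_gt0 => //; lra.
by lra.
Qed.

Lemma convex_points r p q t : all (fun A => convex_form A.2) r ->
  0 <= t <= 1 -> points r p -> points r q -> points r (toward p q t).
Proof.
move=> /allP rC t01 /allP pr /allP qr; apply/allP => A Ar.
by apply: holds_convex (pr A Ar) (qr A Ar) => //; exact: rC.
Qed.

End Connected.

Section ConnectedRegions.
Variable R : realType.
Implicit Types (f : seq Z) (r H T : region) (p q w : Cplx R) (t x y : R).

Notation coef f i := (zval R (nth Z0 f i)).

Lemma void_pull_rot k T : vacant R T -> vacant R (pull (iter k pull_rot) T).
Proof.
move=> hT v v0; rewrite (inside_pull _ _ (adjoint_iter k (@adjoint_rot R))).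
exact/hT/null_iter_rot.
Qed.

Lemma connecting_voidsP : {in connecting_voids, forall T, vacant R T}.
Proof.
apply: void_cat; first exact: fibre_voidsP.
apply: void_cat.
  move=> T; rewrite !inE => /orP[] /eqP->.
    exact: void_pull_rot 3 _ (void_sub1 (@void_half_square R)).
  exact: void_pull_rot 1 _ (void_sub1 (void_pull_rot 3 (@void_half_square R))).
apply: void_cat; last exact: void_seq1 (@void_origin R).
apply/void_rotations/(void_cat (Ts := [:: _])); first exact: void_seq1 (@void_one_strict R).
apply: (void_cat (Ts := [:: _])); first exact: void_seq1 (@void_corner R).
exact: void_square.
Qed.

Lemma covered_points H Ts w :
  covered 4 (finite_pt ++ H) (connecting_voids ++ Ts) -> points H w ->
  exists2 T, T \in Ts & points T w.
Proof.
move=> h Hw; apply: (coveredVP connecting_voidsP h (null_qpoint w)).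
by rewrite insideC finite_ptE ?ltr01//; exact: null_qpoint.
Qed.

Lemma covered_points1 H T w :
  covered 4 (finite_pt ++ H) (connecting_voids ++ [:: T]) ->
  points H w -> points T w.
Proof. by move=> h /(covered_points h)[T']; rewrite inE => /eqP->. Qed.

Lemma value_slope f p q t : value f (toward p q t) = value f p +
  t * (2 * coef f 0 * (complex.Re p * (complex.Re q - complex.Re p) +
                       complex.Im p * (complex.Im q - complex.Im p)) +
       coef f 1 * (complex.Re q - complex.Re p) +
       coef f 2 * (complex.Im q - complex.Im p)) +
  coef f 0 * (t ^+ 2 * ((complex.Re q - complex.Re p) ^+ 2 +
                        (complex.Im q - complex.Im p) ^+ 2)).
Proof. by case: p => x y; case: q => x' y'; rewrite /toward !valueE /=; ring. Qed.

Lemma holds_slope (A : constraint) p q t : 0 <= coef A.2 0 -> 0 <= t ->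
  0 <= 2 * coef A.2 0 * (complex.Re p * (complex.Re q - complex.Re p) +
                         complex.Im p * (complex.Im q - complex.Im p)) +
       coef A.2 1 * (complex.Re q - complex.Re p) +
       coef A.2 2 * (complex.Im q - complex.Im p) ->
  holds (qseq (qpoint p)) A -> holds (qseq (qpoint (toward p q t))) A.
Proof.
move=> a0 t0 s0; rewrite !holds_value value_slope.
have h1 := mulr_ge0 t0 s0.
have h2 : 0 <= coef A.2 0 * (t ^+ 2 * ((complex.Re q - complex.Re p) ^+ 2 +
    (complex.Im q - complex.Im p) ^+ 2)).
  by apply: mulr_ge0 => //; apply: mulr_ge0; rewrite ?addr_ge0// sqr_ge0.
move: h1 h2; set u := t * _; set v := coef _ _ * _; clear => h1 h2.
by case: A.1; lra.
Qed.

Definition shift p (v : Z * Z) : Cplx R :=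
  (complex.Re p + zval R v.1) +i* (complex.Im p + zval R v.2).

Lemma value_translate f p (v : Z * Z) : Z.eqb (nth Z0 f 0) 0 ->
  value (translate v.1 v.2 f) p = value f (shift p v).
Proof.
move=> /Z.eqb_eq f0; case: p => x y; rewrite !valueE /= f0.
by rewrite !zvalD !zvalM /zval /=; ring.
Qed.

(** All forms of [r] have nonnegative quadratic coefficient, so along a ray each is convex in the
    parameter, and a nonnegative derivative at [p] keeps it from decreasing. The segment to the
    translate of [p] thus stays in [r]; it ends in the convex hub given by [far] and the linear
    constraints of [r]. *)
Lemma drift_connected dirs far r : connects (Drift dirs far) r ->
  connected (points r : set (Cplx R)).
Proof.
rewrite /connects; case: ifP => // /andP[/allP r0 far0] /andP[c1 c2].
pose C := far :: [seq A <- r | Z.eqb (nth Z0 A.2 0) 0].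
have zero_convex (A : constraint) : Z.eqb (nth Z0 A.2 0) 0 -> convex_form A.2.
  by move=> /Z.eqb_eq h; rewrite /convex_form h.
have CC : all (fun A => convex_form A.2) C.
  rewrite /C /= zero_convex//=; apply/allP => A; rewrite mem_filter => /andP[+ _].
  exact: zero_convex.
apply: (@connected_hub R _ (points C)).
- by move=> w; exact: covered_points1.
- by move=> p q t Cp Cq t01; exact: convex_points CC t01 Cp Cq.
move=> p rp; have [T /mapP[v _ ->] /andP[farp /allP hp]] := covered_points c2 rp.
have along t : 0 <= t -> points r (toward p (shift p v) t).
  move=> t0; apply/allP => A Ar; apply: holds_slope t0 _ _.
  - exact/zval_ge0/r0.
  - have := hp _ (map_f (fun A : constraint => (false, drift v.1 v.2 A.2)) Ar).
    rewrite /holds /qseq lform_quad /= !zvalD !zvalM.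
    have -> : zval R 2 = 2 by [].
    have -> : zval R 0 = 0 by [].
    case: p {rp farp hp} => x y /=; rewrite ![_ + zval R _ - _]addrC !addKr.
    by congr (0 <= _); ring.
  - by have /allP := rp; apply.
exists (shift p v); last by move=> t /andP[t0 _]; exact: along.
apply/andP; split.
  by move: farp; rewrite !holds_value value_translate.
apply/allP => A; rewrite mem_filter => /andP[_ Ar].
by have /allP/(_ A Ar) := along 1 ler01; rewrite toward1.
Qed.

(** On the segment to -1 the convex constraints hold because they hold at both ends, and the others
    because their slope at [p] is nonnegative. *)
Lemma star_connected r : connects Star r -> connected (points r : set (Cplx R)).
Proof.
rewrite /connects; case: ifP => // /allP r1 c1.
pose q : Cplx R := (-1) +i* 0.
have valq f : value f q = zval R (star_value f).
  by rewrite valueE /star_value /Z.sub !zvalD zvalN; ring.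
have rq : points r q.
  apply/allP => A /r1; rewrite holds_value valq; case: A.1.
    exact: zval_gt0.
  exact: zval_ge0.
apply: (@connected_hub R _ [set q]).
- by move=> _ ->.
- move=> _ _ t -> -> _; rewrite /toward !subrr !mulr0 !addr0.
  by case: (q).
move=> p rp; exists q => // t /andP[t0 t1].
have /allP hp := covered_points1 c1 rp.
apply/allP => A Ar; have Ap : holds (qseq (qpoint p)) A by have /allP := rp; apply.
have [Ac|Ac] := boolP (convex_form A.2).
  apply: holds_convex => //; first by rewrite t0.
  by have /allP := rq; apply.
apply: holds_slope t0 _ Ap.
  by apply: zval_ge0; move: Ac; rewrite /convex_form; case: (nth _ _ _).
have := hp (false, star_drift A.2); rewrite (map_f (fun A : constraint => (false, star_drift A.2))).
  move=> /(_ isT); rewrite /holds /qseq lform_quad /= !(zvalD, zvalN, zvalM).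
  have -> : zval R 2 = 2 by [].
  by case: p {rp hp} => x y /=; congr (0 <= _); ring.
by rewrite mem_filter Ac.
Qed.

Definition reciprocal w : Cplx R :=
  (complex.Re w / qn (qpoint w)) +i* (- complex.Im w / qn (qpoint w)).

Lemma qpoint_reciprocal w : 0 < qn (qpoint w) ->
  qpoint (reciprocal w) = qscale (qn (qpoint w))^-1 (qinv (qpoint w)).
Proof.
case: w => x y /= n0; rewrite /qpoint /qscale /=.
by congr Quad; field; rewrite gt_eqF.
Qed.

Lemma reciprocalK w : 0 < qn (qpoint w) -> reciprocal (reciprocal w) = w.
Proof.
move=> n0; rewrite {1}/reciprocal (qpoint_reciprocal n0).
case: w n0 => x y n0 /=; apply/eqP; rewrite eq_complex /=.
by apply/andP; split; apply/eqP; field; rewrite gt_eqF.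
Qed.

Lemma qn_reciprocal w : 0 < qn (qpoint w) -> 0 < qn (qpoint (reciprocal w)).
Proof. by move=> n0; rewrite qpoint_reciprocal //= mulr1 invr_gt0. Qed.

Lemma points_reciprocal H w : 0 < qn (qpoint w) ->
  points H (reciprocal w) = points (pull pull_inv H) w.
Proof.
move=> n0; rewrite /points /= qpoint_reciprocal// inside_scale ?invr_gt0//.
by rewrite (inside_pull _ _ (@adjoint_inv R)).
Qed.

Lemma nonzeroE w : points [:: nonzero] w = (0 < qn (qpoint w)) :> Prop.
Proof.
by rewrite /points /inside /= andbT holds_value /nonzero /= /value /qseq lform_quad /=
  /zval /= !mul0r !addr0 mul1r.
Qed.

Lemma continuous_reciprocal w : 0 < qn (qpoint w) ->
  {for w, continuous reciprocal}.
Proof.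
move=> n0; have rw := @continuous_Re R w; have iw := @continuous_Im R w.
have qw : {for w, continuous (fun w => qn (qpoint w) : R)}.
  rewrite /= (_ : (fun w => _) = fun w => complex.Re w * complex.Re w +
    complex.Im w * complex.Im w); last by apply/funext => z; rewrite !expr2.
  exact: cvgD (cvgM rw rw) (cvgM iw iw).
have nw : {for w, continuous (fun w => (qn (qpoint w))^-1 : R)}.
  exact: cvgV (lt0r_neq0 n0) qw.
apply: (@continuous_pair R _ (fun w => _) (fun w => _) w).
  exact: cvgM rw nw.
exact: cvgM (cvgN iw) nw.
Qed.

(** The last covering keeps 0 out of [H], so that the reciprocal is continuous there; the first two
    identify [r] with the image of [H]. *)
Lemma inverse_connected H P r : connected (points H : set (Cplx R)) ->
  connects (Inverse H P) r -> connected (points r : set (Cplx R)).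
Proof.
move=> cH; rewrite /connects -/connects; case: ifP => // _ /and3P[c1 c2 c3].
have H0 w : points H w -> 0 < qn (qpoint w).
  by move=> /(covered_points1 c3); rewrite nonzeroE.
have cons_points A T w : points (A :: T) w = (points [:: A] w /\ points T w) :> Prop.
  by rewrite /points /inside /= andbT; apply/propext; split => [/andP|[-> ->]].
have -> : points r = reciprocal @` (points H : set (Cplx R)).
  apply/seteqP; split=> [w /(covered_points1 c1)|_ [w Hw <-]].
    rewrite cons_points nonzeroE => -[w0 Hw]; exists (reciprocal w).
      by rewrite points_reciprocal.
    exact: reciprocalK.
  have w0 := H0 w Hw; apply: (covered_points1 c2); rewrite cons_points nonzeroE.
  by rewrite -points_reciprocal ?qn_reciprocal// reciprocalK.
apply: connected_continuous_connected => //.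
by apply: continuous_in_subspaceT => w /set_mem/H0; exact: continuous_reciprocal.
Qed.

Lemma connectsP P r : connects P r -> connected (points r : set (Cplx R)).
Proof.
elim: P r => [|dirs far||H P IH] r.
- move=> rC; apply: (@connected_hub R _ (points r)) => //.
    by move=> p q t rp rq t01; exact: convex_points.
  by move=> p rp; exists p => // t t01; exact: convex_points.
- exact: drift_connected.
- exact: star_connected.
- move=> h; apply: inverse_connected (h); apply: IH.
  by move: h; rewrite /connects -/connects; case: ifP.
Qed.

Lemma connected_rotation k H : connected (points H : set (Cplx R)) ->
  connected (points (pull (iter k pull_rot) H) : set (Cplx R)).
Proof.
elim: k => [|k IH] cH; first by rewrite -iter_pull.
have {IH}cH := IH cH.
rewrite -iter_pull /= iter_pull; move: (pull _ H) cH => {}H cH.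
pose rot w : Cplx R := (- complex.Im w) +i* complex.Re w.
have -> : points (pull pull_rot H) = rot @` (points H : set (Cplx R)).
  have rotE w : points (pull pull_rot H) (rot w) = points H w.
    rewrite /points /= (inside_pull _ _ (@adjoint_rot R)) /qrot /=.
    case: w => x y; rewrite /qpoint /= opprK.
    by congr (is_true (inside _ (qseq (Quad _ _ _ _)))); ring.
  apply/seteqP; split=> [[x y] Hw|_ [w Hw <-]]; last by rewrite rotE.
  have e : rot (y +i* - x) = x +i* y by rewrite /rot /= opprK.
  by exists (y +i* - x) => //; rewrite -rotE e.
apply: connected_continuous_connected => //; apply: continuous_subspaceT => w.
apply: (@continuous_pair R _ (fun w => _) (fun w => _) w).
  exact: cvgN (@continuous_Im R w).
exact: (@continuous_Re R w).
Qed.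

Lemma cell_connected k (c : cell) r : c \in cells -> r \in c.1 :: c.2 ->
  connected (points (pull (iter k pull_rot) r) : set (Cplx R)).
Proof.
move=> cC rc; apply: connected_rotation.
have /allP/(_ r) := connected_checkT; rewrite mem_undup.
have -> : r \in flatten [seq c.1 :: c.2 | c <- cells].
  by apply/flattenP; exists (c.1 :: c.2) => //; apply/mapP; exists c.
move=> /(_ isT); rewrite -has_find.
by elim: reasons => // P Ps IH /orP[/connectsP|/IH].
Qed.

End ConnectedRegions.

(** * The pieces of the domain *)

Definition constraint_description (A : constraint) : description :=
  let n i := int_of_Z (nth Z0 A.2 i) in
  if A.1 then Compl (Ineq (- n 0%N) (- n 1%N) (- n 2%N) (- n 3%N))
  else Ineq (n 0%N) (n 1%N) (n 2%N) (n 3%N).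

Definition region_description (H : region) : description :=
  foldr (fun A e => Inter (constraint_description A) e) (Ineq 0 0 0 0) H.

Definition pieces : seq (region * region) :=
  flatten [seq [seq (pull (iter q.1 pull_rot) r, pull (iter q.1 pull_rot) q.2.1)
                | r <- q.2.2]
           | q <- [seq (k, c) | k <- iota 0 4, c <- cells]].

Definition proper_check : bool :=
  all (fun P : region * region => all (fun A => proper_curve A.2) P.1 &&
    all (fun A => proper_curve A.2) P.2) pieces.

Lemma proper_checkT : proper_check.
Proof. by vm_compute. Qed.

Section Pieces.
Variable R : realType.
Implicit Types (H : region) (w : Cplx R) (z : sphere R).

Definition sphere_points H : set (sphere R) := [set z | inside H (qseq (qsphere z))].

Lemma explicit_points H : explicit (points H : set (Cplx R)).
Proof.
exists (region_description H); apply/funext => w; rewrite /points /=; apply/propext.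
suff -> : described (region_description H) w = inside H (qseq (qpoint w)) by [].
elim: H => [|A H IH] /=; first by rewrite !mul0r !addr0 lexx.
rewrite {}IH; congr andb; rewrite /holds /qseq lform_quad mulr1.
case: A => -[] f /=; rewrite /zval; last by [].
by rewrite -ltNge !rmorphN !mulNr -!opprD oppr_lt0.
Qed.

Lemma explicit_region_points H : connected (points H : set (Cplx R)) ->
  all (fun A => proper_curve A.2) H -> explicit_region (points H : set (Cplx R)).
Proof.
move=> cH /allP Hp; split=> //; first exact: explicit_points.
exact: region_boundary.
Qed.

Lemma piecesP P : P \in pieces <-> exists k c r,
  [/\ (k < 4)%N, c \in cells, r \in c.2 &
      P = (pull (iter k pull_rot) r, pull (iter k pull_rot) c.1)].
Proof.
split=> [/flattenP[_ /mapP[_ /allpairsP[[k c] [k4 cC ->]] ->] /mapP[r rc ->]]|].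
  by exists k, c, r; rewrite mem_iota add0n in k4.
move=> [k [c [r [k4 cC rc ->]]]]; apply/flattenP.
exists [seq (pull (iter k pull_rot) r, pull (iter k pull_rot) c.1) | r <- c.2].
  apply/mapP; exists (k, c) => //; apply/allpairsP; exists (k, c).
  by rewrite mem_iota.
by apply/mapP; exists r.
Qed.

Lemma domain_pieces : domain (R := R) = \bigcup_(k < size pieces)
  (sphere_points (nth ([::], [::]) pieces k).1 `*`
   points (nth ([::], [::]) pieces k).2).
Proof.
have inE' k r v : inside (pull (iter k pull_rot) r) (qseq v) =
    inside r (qseq (iter k (@qrot R) v)).
  exact: inside_pull (adjoint_iter k (@adjoint_rot R)).
apply/seteqP; split=> [[z w] [k [c [cC wc /hasP[r rc rz]]]]|[z w] [k kN [/= zk wk]]].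
  rewrite iter_rot_mod in wc; rewrite iter_rot_mod in rz.
  have /(nthP ([::], [::]))[j jN jE] : (pull (iter (k %% 4) pull_rot) r,
      pull (iter (k %% 4) pull_rot) c.1) \in pieces.
    by apply/piecesP; exists (k %% 4)%N, c, r; rewrite ltn_mod.
  by exists j => //; rewrite jE /sphere_points /points; split; rewrite /= inE'.
have /piecesP[j [c [r [_ cC rc jE]]]] := mem_nth ([::], [::]) kN.
rewrite jE /sphere_points /= inE' in zk; rewrite jE /points /= inE' in wk.
by exists j, c; split=> //; apply/hasP; exists r.
Qed.

Lemma consistent_piece P : P \in pieces -> consistent (points P.2 : set (Cplx R)).
Proof.
move=> /piecesP[k [c [r [_ cC _ ->]]]].
have inE' w : points (pull (iter k pull_rot) c.1) w =
    inside c.1 (qseq (iter k (@qrot R) (qpoint w))) :> Prop.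
  by rewrite /points /= (inside_pull _ _ (adjoint_iter k (@adjoint_rot R))).
have [cI|cO] := cellsP cC.
  by exists genS => w /=; rewrite inE' => /(branch_inner cI)[].
by exists (sector_gen k) => w /=; rewrite inE' => /(branch_outer cO).
Qed.

Lemma explicit_region_piece P : P \in pieces ->
  explicit_region (points P.1 : set (Cplx R)) /\
  explicit_region (points P.2 : set (Cplx R)).
Proof.
move=> PP; have /allP/(_ P PP)/andP[p1 p2] := proper_checkT.
have /piecesP[k [c [r [_ cC rc PE]]]] := PP.
by split; apply: explicit_region_points => //; rewrite PE;
  apply: cell_connected cC _; rewrite inE ?eqxx// rc orbT.
Qed.

End Pieces.

(** * Nonempty interior, and the conclusion *)

(** Gives content to the exception made for boundary points: a domain with empty interior would be
    contained in its own boundary. *)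
Lemma domain_interior (R : realType) : (domain (R := R))° !=set0.
Proof.
pose U := [set z : Cplx R | complex.Re z < -1 /\ `|complex.Im z| < 1 / 2].
pose V := [set w : Cplx R | 2 < complex.Re w /\ `|complex.Im w| < 1 / 2].
have near (p : Cplx R) (A : set (Cplx R)) : complex.Im p = 0 ->
    (forall w : Cplx R, `|complex.Re w - complex.Re p| < 1 / 2 ->
      `|complex.Im w| < 1 / 2 -> A w) -> nbhs p A.
  move=> p0 pA; apply: (proj2 (nbhs_discP p A)); exists (1 / 2) => [|w wp]; first lra.
  have := le_lt_trans (Re_le_normc _) wp; have := le_lt_trans (Im_le_normc _) wp.
  by rewrite !raddfB /= p0 subr0 => ? ?; exact: pA.
(* [core] contains a neighbourhood of 5, and its fibre [strip] contains one of -5. *)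
exists (Some ((- 5) +i* 0), 5 +i* 0), (Some @` U, V).
  split; first apply: one_point_compactification_some_nbhs.
    by apply: near => // w; rewrite /= ltr_norml => /andP[? ?] ?; split=> //; lra.
  by apply: near => // w; rewrite /= ltr_norml => /andP[? ?] ?; split=> //; lra.
move=> [z' w] [/= [z [z1 z2] <-] [w1 w2]]; exists 0%N, core.
move: z1 z2 w1 w2; case: z => x y; case: w => u v /=.
rewrite !ltr_norml => x1 /andP[y1 y2] u1 /andP[v1 v2].
split.
- by rewrite mem_cat; apply/orP; right; rewrite inE eqxx.
- by rewrite /inside /holds /= ?zvals andbT; apply/andP; split; lra.
apply/hasP; exists strip; first by rewrite inE eqxx.
have := sqr_ge0 x; have := sqr_ge0 y; rewrite /inside /holds /= ?zvals andbT => y0 x0.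
by apply/and4P; split; lra.
Qed.

Theorem theorem7 (R : realType) :
  exists D : set (sphere R * Cplx R),
    [/\ D `<=` off_diagonal (R:=R),
        D° !=set0,
        bijectivity_domain D &
        exists (N : nat) (Z : 'I_N -> set (sphere R)) (W : 'I_N -> set (Cplx R)),
          [/\ D = \bigcup_k (Z k `*` W k),
              (forall k, consistent (W k)),
              (forall k, explicit_region (finite_part (Z k))) &
              (forall k, explicit_region (W k))]].
Proof.
exists (domain (R := R)); split.
- exact: domain_off_diagonal.
- exact: domain_interior.
- exact: domain_bijectivity.
pose piece (k : 'I_(size pieces)) := nth ([::], [::]) pieces k.
have pieceP k : piece k \in pieces by exact: mem_nth.
exists (size pieces), (fun k => sphere_points (piece k).1), (fun k => points (piece k).2).
split=> [|k|k|k].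
- rewrite domain_pieces; apply/seteqP; split=> [p [k kN pk]|p [k _ pk]].
    by exists (Ordinal kN).
  by exists k; [exact: ltn_ord | exact: pk].
- exact: consistent_piece.
- by have [h _] := explicit_region_piece R (pieceP k).
- by have [_ h] := explicit_region_piece R (pieceP k).
Qed.
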